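(* Let $G$ be a simply connected five dimensional nilpotent Lie group with a left invariant Riemannian metric $\tilde a$, whose Lie algebra $\mathfrak l_{5,9}$ has an $\tilde a$-orthonormal basis $\{E_1,\dots,E_5\}$ with non-zero brackets $[E_1,E_2]=kE_3+lE_4+mE_5$, $[E_1,E_3]=pE_4$, $[E_2,E_3]=qE_5$, where either $k>0$, $q>p>0$ and $l,m\ge0$, or $k,p>0$, $l\ge0$, $m=0$ and $q=p$. If $F$ is any left invariant non-Riemannian $(\alpha,\beta)$-metric of Douglas type on $G$ defined by $\tilde a$ and a left invariant vector field $X$, then $F$ must be a Randers metric.
   Context: Brackets of basis elements not listed (and not obtained by antisymmetry) are zero. An $(\alpha,\beta)$-metric is a Finsler metric $F=\alpha\,\phi(\beta/\alpha)$, where $\alpha(x,y)=\sqrt{\tilde a(y,y)}$ is the norm of a Riemannian metric $\tilde a$, $\beta$ is a 1-form, and $\phi:(-b_0,b_0)\to\mathbb R^+$ is a $C^\infty$ function with $\phi(s)-s\phi'(s)+(b^2-s^2)\phi''(s)>0$ for $|s|\le b<b_0$, and $\|\beta_x\|_\alpha<b_0$ for all $x$. It is defined by $\tilde a$ and a vector field $X$ if $\beta(x,y)=\tilde a(y,X(x))$; here $\tilde a$ and $X$ are left invariant. A Randers metric is a Finsler metric of the form $\alpha+\beta$ (the case $\phi(s)=1+s$, $b_0=1$), with $\alpha$ the norm of a Riemannian metric and $\beta$ a 1-form of $\alpha$-norm less than one. The spray coefficients of $F$ in standard local coordinates $(x,y)$ of the tangent bundle are $G^i=\frac14 g^{ij}\big([F^2]_{x^ry^j}y^r-[F^2]_{x^j}\big)$,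 where $g_{ij}=\frac12\frac{\partial^2F^2}{\partial y^i\partial y^j}$. $F$ is of Douglas type if in every standard local coordinate system $G^i=\frac12\Gamma^i_{jr}(x)y^jy^r+P(x,y)y^i$ for some functions $\Gamma^i_{jr}(x)$ and some local function $P(x,y)$ positively homogeneous of degree one in $y$. *)

(* Defs.v *)
(* A tangent vector is represented by the directional derivative it induces on
   real-valued functions, extended by 0 to the functions that are not smooth
   near the base point. This representation is faithful and chart-free: two
   pairs (chart, coordinate vector) at a point denote the same tangent vector
   iff they give the same functional. *)
From HB Require Import structures.
From mathcomp Require Import all_boot all_order all_algebra.
From mathcomp Require Import all_classical all_reals all_analysis.

Set Implicit Arguments.
Unset Strict Implicit.
Unset Printing Implicit Defensive.

Import Order.TTheory GRing.Theory Num.Theory.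
Import numFieldNormedType.Exports.

Local Open Scope classical_set_scope.
Local Open Scope ring_scope.

Definition iter_derive (R : realType) (V W : normedModType R) (s : seq V)
    (f : V -> W) : V -> W :=
  foldr (fun v g x => 'D_v g x) f s.

(* For V finite-dimensional and U open: existence and continuity on U of the
   partial derivatives of all orders, i.e. C^oo in the usual sense. *)
Definition Cinfty (R : realType) (V W : normedModType R) (U : set V)
    (f : V -> W) : Prop :=
  forall (s : seq V) (x : V), U x ->
    {for x, continuous (iter_derive s f)} /\
    (forall v, derivable (iter_derive s f) x v).

(* [cmap] and [cinv] are only meaningful on [cdom] and on its image. *)
Record chart (R : realType) (n : nat) (M : topologicalType) := Chart {
  cdom : set M ;
  cmap : M -> 'rV[R]_n ;
  cinv : 'rV[R]_n -> M ;
  cdom_open : open cdom ;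
  cimg_open : open (cmap @` cdom) ;
  cmapK : forall p, cdom p -> cinv (cmap p) = p ;
  cmap_continuous : forall p, cdom p -> {for p, continuous cmap} ;
  cinv_continuous : forall x, (cmap @` cdom) x -> {for x, continuous cinv}
}.

Definition cimg (R : realType) (n : nat) (M : topologicalType)
    (c : chart R n M) : set 'rV[R]_n := cmap c @` cdom c.

Definition smooth_transition (R : realType) (n : nat) (M : topologicalType)
    (c c' : chart R n M) : Prop :=
  Cinfty (cmap c @` (cdom c `&` cdom c')) (cmap c' \o cinv c).

(* A maximal smooth atlas; its members are the standard local coordinate
   systems. *)
Record smooth_structure (R : realType) (n : nat) (M : topologicalType) :=
  SmoothStructure {
  atlas : set (chart R n M) ;
  atlas_cover : forall p, exists2 c, atlas c & cdom c p ;
  atlas_smooth : forall c c', atlas c -> atlas c' -> smooth_transition c c' ;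
  atlas_maximal : forall c,
    (forall c', atlas c' -> smooth_transition c c' /\ smooth_transition c' c) ->
    atlas c
}.

Definition smooth_on (R : realType) (n : nat) (M : topologicalType)
    (A : smooth_structure R n M) (U : set M) (f : M -> R) : Prop :=
  forall c, atlas A c -> Cinfty (cmap c @` (cdom c `&` U)) (f \o cinv c).

Definition smooth_near (R : realType) (n : nat) (M : topologicalType)
    (A : smooth_structure R n M) (p : M) (f : M -> R) : Prop :=
  exists U : set M, [/\ open U, U p & smooth_on A U f].

Definition tvec (R : realType) (M : Type) := (M -> R) -> R^o.

Definition vfield (R : realType) (M : Type) := M -> tvec R M.

(* \sum_i y_i d/dx^i at the point with coordinates x *)
Definition coord_vec (R : realType) (n : nat) (M : topologicalType)
    (A : smooth_structure R n M) (c : chart R n M) (x y : 'rV[R]_n) :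
    tvec R M :=
  fun f => if `[< smooth_near A (cinv c x) f >]
           then 'D_y (f \o cinv c : 'rV[R]_n -> R^o) x else 0.

Definition tangent (R : realType) (n : nat) (M : topologicalType)
    (A : smooth_structure R n M) (p : M) (v : tvec R M) : Prop :=
  exists c y, [/\ atlas A c, cdom c p & v = coord_vec A c (cmap c p) y].

Definition is_vector_field (R : realType) (n : nat) (M : topologicalType)
    (A : smooth_structure R n M) (X : vfield R M) : Prop :=
  (forall p, tangent A p (X p)) /\
  (forall (U : set M) (f : M -> R), open U -> smooth_on A U f ->
     smooth_on A U (fun q => X q f)).

(* Without the test, the formula could be nonzero on functions that are not
   smooth near p, and the result would not satisfy [tangent]. *)
Definition lie_bracket (R : realType) (n : nat) (M : topologicalType)
    (A : smooth_structure R n M) (X Y : vfield R M) : vfield R M :=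
  fun p f => if `[< smooth_near A p f >]
             then X p (fun q => Y q f) - Y p (fun q => X q f) else 0.

Definition one_form (R : realType) (n : nat) (M : topologicalType)
    (A : smooth_structure R n M) (beta : M -> tvec R M -> R) : Prop :=
  (forall p (t : R) u v, tangent A p u -> tangent A p v ->
     beta p (t *: u + v) = t * beta p u + beta p v) /\
  (forall c, atlas A c -> forall y,
     Cinfty (cimg c)
       (fun x => beta (cinv c x) (coord_vec A c x y) : R^o)).

Definition riemannian (R : realType) (n : nat) (M : topologicalType)
    (A : smooth_structure R n M) (a : M -> tvec R M -> tvec R M -> R) : Prop :=
  [/\ forall p u v, tangent A p u -> tangent A p v -> a p u v = a p v u,
      forall p (t : R) u v w, tangent A p u -> tangent A p v ->
        tangent A p w -> a p (t *: u + v) w = t * a p u w + a p v w,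
      forall p v, tangent A p v -> v != 0 -> 0 < a p v v
    & forall c, atlas A c -> forall y z,
        Cinfty (cimg c) (fun x =>
          a (cinv c x) (coord_vec A c x y) (coord_vec A c x z) : R^o)].

Definition riem_norm (R : realType) (M : Type)
    (a : M -> tvec R M -> tvec R M -> R) (p : M) (v : tvec R M) : R :=
  Num.sqrt (a p v v).

Definition form_norm (R : realType) (n : nat) (M : topologicalType)
    (A : smooth_structure R n M) (a : M -> tvec R M -> tvec R M -> R)
    (beta : M -> tvec R M -> R) (p : M) : R :=
  sup [set r | exists v, [/\ tangent A p v, riem_norm a p v <= 1
                           & r = `|beta p v|]].

Definition local_expr (R : realType) (n : nat) (M : topologicalType)
    (A : smooth_structure R n M) (F : M -> tvec R M -> R) (c : chart R n M)
    (x y : 'rV[R]_n) : R :=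
  F (cinv c x) (coord_vec A c x y).

Definition partial_x (R : realType) (n : nat) (i : 'I_n)
    (H : 'rV[R]_n -> 'rV[R]_n -> R) (x y : 'rV[R]_n) : R :=
  'D_(delta_mx 0 i) (fun x' => H x' y : R^o) x.

Definition partial_y (R : realType) (n : nat) (i : 'I_n)
    (H : 'rV[R]_n -> 'rV[R]_n -> R) (x y : 'rV[R]_n) : R :=
  'D_(delta_mx 0 i) (fun y' => H x y' : R^o) y.

Definition fundamental_tensor (R : realType) (n : nat) (M : topologicalType)
    (A : smooth_structure R n M) (F : M -> tvec R M -> R) (c : chart R n M)
    (x y : 'rV[R]_n) : 'M[R]_n :=
  let F2 x y := local_expr A F c x y ^+ 2 in
  \matrix_(i, j) (2^-1 * partial_y j (partial_y i F2) x y).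

Definition finsler (R : realType) (n : nat) (M : topologicalType)
    (A : smooth_structure R n M) (F : M -> tvec R M -> R) : Prop :=
  [/\ forall p v, tangent A p v -> 0 <= F p v,
      forall p (t : R) v, 0 < t -> tangent A p v -> F p (t *: v) = t * F p v,
      forall c, atlas A c ->
        Cinfty [set z : 'rV[R]_n * 'rV[R]_n | cimg c z.1 /\ z.2 != 0]
               (fun z => local_expr A F c z.1 z.2 : R^o)
    & forall c, atlas A c -> forall x y w : 'rV[R]_n,
        cimg c x -> y != 0 -> w != 0 ->
        0 < \sum_i \sum_j fundamental_tensor A F c x y i j * w 0 i * w 0 j].

Definition spray (R : realType) (n : nat) (M : topologicalType)
    (A : smooth_structure R n M) (F : M -> tvec R M -> R) (c : chart R n M)
    (x y : 'rV[R]_n) (i : 'I_n) : R :=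
  let F2 x y := local_expr A F c x y ^+ 2 in
  4^-1 * \sum_j invmx (fundamental_tensor A F c x y) i j *
    (\sum_r partial_y j (partial_x r F2) x y * y 0 r - partial_x j F2 x y).

Definition douglas (R : realType) (n : nat) (M : topologicalType)
    (A : smooth_structure R n M) (F : M -> tvec R M -> R) : Prop :=
  forall c, atlas A c ->
  exists (Gamma : 'I_n -> 'I_n -> 'I_n -> 'rV[R]_n -> R)
         (P : 'rV[R]_n -> 'rV[R]_n -> R),
    (forall (t : R) x y, cimg c x -> y != 0 -> 0 < t ->
       P x (t *: y) = t * P x y) /\
    (forall x y, cimg c x -> y != 0 -> forall i,
       spray A F c x y i =
       2^-1 * (\sum_j \sum_r Gamma i j r x * y 0 j * y 0 r) + P x y * y 0 i).

Definition riemannian_finsler (R : realType) (n : nat) (M : topologicalType)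
    (A : smooth_structure R n M) (F : M -> tvec R M -> R) : Prop :=
  exists2 a, riemannian A a &
    forall p v, tangent A p v -> F p v = riem_norm a p v.

Definition randers (R : realType) (n : nat) (M : topologicalType)
    (A : smooth_structure R n M) (F : M -> tvec R M -> R) : Prop :=
  finsler A F /\
  exists a beta,
    [/\ riemannian A a, one_form A beta, forall p, form_norm A a beta p < 1
      & forall p v, tangent A p v -> F p v = riem_norm a p v + beta p v].

(* At the zero vector the right-hand side of the last clause is 0, since
   [riem_norm a p 0 = 0]. *)
Definition alpha_beta_metric (R : realType) (n : nat) (M : topologicalType)
    (A : smooth_structure R n M) (a : M -> tvec R M -> tvec R M -> R)
    (beta : M -> tvec R M -> R) (F : M -> tvec R M -> R) : Prop :=
  [/\ finsler A F, riemannian A a, one_form A beta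
    & exists (b0 : R) (phi : R -> R),
      [/\ 0 < b0,
          Cinfty [set s : R | `|s| < b0] (phi : R -> R^o) /\
            (forall s, `|s| < b0 -> 0 < phi s),
          forall s b, `|s| <= b -> b < b0 ->
            0 < phi s - s * (phi^`())%classic s +
              (b ^+ 2 - s ^+ 2) * (phi^`(2))%classic s,
          forall p, form_norm A a beta p < b0
        & forall p v, tangent A p v ->
            F p v = riem_norm a p v * phi (beta p v / riem_norm a p v)]].

Definition form_of_field (R : realType) (M : Type)
    (a : M -> tvec R M -> tvec R M -> R) (X : vfield R M) :
    M -> tvec R M -> R :=
  fun p v => a p v (X p).

(* The continuity and smoothness of the operations are imposed by
   [is_lie_group]. *)
#[short(type="topGroupCarrierType")]
HB.structure Definition TopGroupCarrier := {G of Topological G & Group G}.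

Definition is_lie_group (R : realType) (n : nat) (G : topGroupCarrierType)
    (A : smooth_structure R n G) : Prop :=
  [/\ hausdorff_space G /\ @second_countable G,
      continuous (fun z : G * G => (z.1 * z.2)%g),
      continuous (fun g : G => g^-1%g),
      forall c1 c2 c3, atlas A c1 -> atlas A c2 -> atlas A c3 ->
        Cinfty [set z : 'rV[R]_n * 'rV[R]_n |
                  [/\ cimg c1 z.1, cimg c2 z.2
                    & cdom c3 (cinv c1 z.1 * cinv c2 z.2)%g]]
               (fun z => cmap c3 (cinv c1 z.1 * cinv c2 z.2)%g)
    & forall c1 c2, atlas A c1 -> atlas A c2 ->
        Cinfty [set x | cimg c1 x /\ cdom c2 (cinv c1 x)^-1%g]
               (fun x => cmap c2 (cinv c1 x)^-1%g)].

Definition simply_connected (R : realType) (T : topologicalType) : Prop :=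
  (forall x y : T, exists gamma : R -> T,
     [/\ {within `[0, 1], continuous gamma}, gamma 0 = x & gamma 1 = y]) /\
  (forall gamma : R -> T,
     {within `[0, 1], continuous gamma} -> gamma 0 = gamma 1 ->
     exists H : R * R -> T,
       [/\ {within `[0, 1] `*` `[0, 1], continuous H},
           forall t, t \in `[0, 1] -> H (0, t) = gamma t /\ H (1, t) = gamma 0
         & forall s, s \in `[0, 1] ->
             H (s, 0) = gamma 0 /\ H (s, 1) = gamma 0]).

(* All left-normed commutators [~ .. [~ g, s_1], .., s_c] of some length are
   trivial. *)
Definition nilpotent_group (G : groupType) : Prop :=
  exists c : nat, forall (g : G) (s : seq G), size s = c ->
    foldl (fun x y : G => [~ x, y]%g) g s = 1%g.

Definition dleft (R : realType) (G : groupType) (g : G) (v : tvec R G) :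
    tvec R G :=
  fun f => v (fun q => f (g * q)%g).

Definition left_invariant_field (R : realType) (n : nat)
    (G : topGroupCarrierType) (A : smooth_structure R n G)
    (X : vfield R G) : Prop :=
  is_vector_field A X /\ forall g p, X (g * p)%g = dleft g (X p).

Definition lie_algebra_basis (R : realType) (n : nat)
    (G : topGroupCarrierType) (A : smooth_structure R n G) (d : nat)
    (E : 'I_d -> vfield R G) : Prop :=
  (forall i, left_invariant_field A (E i)) /\
  (forall X, left_invariant_field A X ->
     exists! x : 'rV[R]_d, X = \sum_i x 0 i *: E i).

Definition left_invariant_riem (R : realType) (n : nat)
    (G : topGroupCarrierType) (A : smooth_structure R n G)
    (a : G -> tvec R G -> tvec R G -> R) : Prop :=
  forall g p u v, tangent A p u -> tangent A p v ->
    a (g * p)%g (dleft g u) (dleft g v) = a p u v.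

Definition left_invariant_finsler (R : realType) (n : nat)
    (G : topGroupCarrierType) (A : smooth_structure R n G)
    (F : G -> tvec R G -> R) : Prop :=
  forall g p v, tangent A p v -> F (g * p)%g (dleft g v) = F p v.

(* Main.v *)
From HB Require Import structures.
Require Import Defs.
From mathcomp Require Import all_boot all_order all_algebra.
From mathcomp Require Import all_classical all_reals all_analysis.
From mathcomp Require Import ring lra.

(** Let xi be the components of X in the left invariant orthonormal frame and
    b = |xi|. In this frame F is a single function f(u) = |u| phi(<xi,u>/|u|) of
    the components u of a tangent vector, the same at all points. Therefore the
    derivatives of F with respect to the point are governed by the brackets of
    the frame fields, and the Euler-Lagrange expression of F, evaluated on a
    frame field, becomes an algebraic expression in the Lie algebra (Hamel's
    form of the geodesic equations). If the spray has the Douglas form, there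
    is a quadratic map gamma with
      D^2 f(u)(gamma(u), w) = - Df(u)([u, w])     for all unit u and all w;
    the part P y of the spray disappears because f is homogeneous of degree
    one. This is [hamel_of_douglas].

    The equation determines phi. On the plane spanned by xi and a unit vector nu
    orthogonal to xi, the unit vectors are u = (s / b^2) xi + r nu with
    s = <xi,u> and r^2 = 1 - s^2 / b^2. The functions phi, phi', phi'' depend on
    s alone, while gamma and the bracket are polynomial in (s, r), so the parts
    of the equation that are even and odd in r hold separately. The 2-form
    dbeta is - <xi, [u, w]>, and two cases arise.
    - If dbeta is not zero, a suitable plane gives phi' = c s (phi - s phi')
      ([randers_function_of_dbeta_neq0]).
    - If dbeta is zero, but <nu, [xi, nu]> is not zero for some nu orthogonal to
      xi, then phi'' = psi (phi - s phi' + (b^2 - s^2) phi'') with psi constant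
      ([randers_function_of_dbeta_eq0]).
    The first equation is a special case of the second, and the solutions of
    the second are phi(s) = sqrt(k1 + k2 s^2) + k3 s
    ([randers_function_of_ode]). Thus F = sqrt(k1 alpha^2 + k2 beta^2) + k3 beta,
    which is a Randers metric ([randers_of_randers_function]).

    In the given Lie algebra dbeta = 0 forces X to lie in the span of E1 and E2,
    and a vector nu as required is obtained by adding E3 to the vector of this
    span orthogonal to X ([l59_nonkilling_direction]). *)

Import Order.TTheory GRing.Theory Num.Theory.
Import numFieldNormedType.Exports.

Local Open Scope classical_set_scope.
Local Open Scope ring_scope.

Set Implicit Arguments.
Unset Strict Implicit.
Unset Printing Implicit Defensive.

(** * Calculus in finite-dimensional spaces *)

Lemma MVT_direction (R : realType) (V : normedModType R) (f : V -> R)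
    (x v : V) (c : R) :
  (forall t, `|t| <= `|c| -> derivable f (x + t *: v) v) ->
  exists2 t, `|t| <= `|c| & f (x + c *: v) - f x = c * 'D_v f (x + t *: v).
Proof.
move=> df; pose g (t : R) : R := f (x + t *: v).
have dg (t : R) : `|t| <= `|c| -> is_derive t 1 g ('D_v f (x + t *: v)).
  move=> tc; have := df _ tc.
  have e : (fun h : R => h^-1 *: ((g \o shift t) (h *: 1) - g t)) =
      (fun h : R => h^-1 *: ((f \o shift (x + t *: v)) (h *: v)
                      - f (x + t *: v))).
    apply/funext => h /=; rewrite /g; congr (_ *: (f _ - _)).
    by rewrite scalerDl [_%:A]mulr1 addrCA addrA.
  by rewrite /derivable -e => dgt; split => //; rewrite /derive e.
have segment (a b : R) : a <= b -> `|a| <= `|c| -> `|b| <= `|c| ->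
    exists2 t, `|t| <= `|c| & g b - g a = (b - a) * 'D_v f (x + t *: v).
  move=> ab; rewrite !ler_norml => /andP[ca ac] /andP[cb bc].
  have inab (t : R) : t \in `[a, b] -> `|t| <= `|c|.
    by rewrite in_itv /= ler_norml => /andP[at_ tb];
       rewrite (le_trans ca at_) (le_trans tb bc).
  have [||t tab ->] := @MVT_segment R g (fun t => 'D_v f (x + t *: v)) a b ab.
  - by move=> t tab; apply: dg; apply: inab; exact: subset_itv_oo_cc tab.
  - by apply: derivable_within_continuous => t /inab /dg[].
  - by exists t; [exact: inab | rewrite mulrC].
have g0 : g 0 = f x by rewrite /g scale0r addr0.
have [c0|/ltW c0] := leP 0 c.
  have [||t tc] := segment 0 c c0; rewrite ?normr0 ?normr_ge0//.
  by rewrite g0 subr0 => e; exists t.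
have [||t tc] := segment c 0 c0; rewrite ?normr0 ?normr_ge0//.
rewrite g0 sub0r => e; exists t => //.
by rewrite -/(g c) -opprB e mulNr opprK.
Qed.

Section C1.
Context {R : realType} {n : nat}.
Implicit Types (f : 'rV[R]_n -> R^o) (x h : 'rV[R]_n).

Let trunc (k : nat) h : 'rV[R]_n := \row_i (if (i < k)%N then h 0 i else 0).

Lemma truncS (k : 'I_n) h :
  trunc k.+1 h = trunc k h + h 0 k *: delta_mx 0 k.
Proof.
apply/rowP => i; rewrite !mxE eqxx /= ltnS leq_eqVlt.
have [->|/negPf ik] := eqVneq i k.
  by rewrite !eqxx /= ltnn mulr1 add0r.
by rewrite (_ : (nat_of_ord i == k) = false) // mulr0 addr0.
Qed.

Lemma coord_norm h (k : 'I_n) : `|h 0 k| <= `|h|.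
Proof.
rewrite [leRHS]/Num.Def.normr /= mx_normrE.
exact: (le_bigmax _ (fun ij : 'I_1 * 'I_n => `|h ij.1 ij.2|) (ord0, k)).
Qed.

(** The increment f(x + h) - f(x) is split along the coordinates of h; by the
    mean value theorem each step is h_k times a partial derivative taken at a
    point whose distance to x is at most the norm of h. *)
Lemma C1_differentiable f x :
  (\near x, forall i, derivable f x (delta_mx 0 i)) ->
  (forall i, {for x, continuous ('D_(delta_mx 0 i) f)}) ->
  differentiable f x.
Proof.
move=> df cf.
(* L is the candidate for the differential. *)
pose L h : R^o := \sum_i h 0 i * 'D_(delta_mx 0 i) f x.
have Llin : linear L.
  move=> t u v; rewrite /L scaler_sumr -big_split /=; apply: eq_bigr => i _.
  by rewrite !mxE mulrDl /GRing.scale /= mulrA.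
pose LM := GRing.isLinear.Build _ _ _ _ _ Llin.
pose LL : {linear 'rV[R]_n -> R^o} := HB.pack L LM.
have Lc : continuous L.
  move=> u; apply: differentiable_continuous.
  rewrite (_ : L = \sum_i (fun h => h 0 i * 'D_(delta_mx 0 i) f x)).
    apply: differentiable_sum => i; apply: differentiableM => //.
    exact: differentiable_coord.
  by apply/funext => h; rewrite fct_sumE.
suff e : (f \o shift x : 'rV[R]_n -> R^o) =
    cst (f x) + LL +o_ (0 : 'rV[R]_n) id.
  by apply/diff_locallyP; rewrite (@diff_unique R 'rV[R]_n R^o f LL x Lc e).
apply/eqaddoP => /= eps eps0.
pose eps' := eps / n.+1%:R.
have eps'0 : 0 < eps' by rewrite divr_gt0.
have [d /= d0 near_x] : exists2 d, 0 < d & forall z, `|z - x| < d -> forall i,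
    derivable f z (delta_mx 0 i) /\
    `|'D_(delta_mx 0 i) f z - 'D_(delta_mx 0 i) f x| <= eps'.
  have near_i i : \forall z \near x,
      `|'D_(delta_mx 0 i) f x - 'D_(delta_mx 0 i) f z| <= eps'.
    by move/cvgrPdist_le: (cf i); apply.
  have /filter_forall near_all := near_i.
  have : \forall z \near x, forall i, derivable f z (delta_mx 0 i) /\
      `|'D_(delta_mx 0 i) f z - 'D_(delta_mx 0 i) f x| <= eps'.
    near=> z => i; split; first by move: i; near: z.
    by rewrite distrC; move: i; near: z.
  move=> /nbhs_ballP[d /= d0]; rewrite -ball_normE => bd.
  by exists d => // z zd; apply: bd; rewrite /= distrC.
near=> h.
have hd : `|h| < d by near: h; apply/nbhs_ballP; exists d => // z;
  rewrite -ball_normE /= sub0r normrN.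
have incr (k : nat) : (k <= n)%N ->
    `|f (x + trunc k h) - f x
      - \sum_(i < n | (i < k)%N) h 0 i * 'D_(delta_mx 0 i) f x|
    <= k%:R * (eps' * `|h|).
  elim: k => [_|k IH kn].
    rewrite big_pred0// (_ : trunc 0 h = 0) ?addr0 ?subrr ?subr0 ?normr0 ?mul0r//.
    by apply/rowP => i; rewrite !mxE.
  pose K := Ordinal kn; have KE : k = K by [].
  have sumS : \sum_(i < n | (i < k.+1)%N) h 0 i * 'D_(delta_mx 0 i) f x =
      h 0 K * 'D_(delta_mx 0 K) f x
      + \sum_(i < n | (i < k)%N) h 0 i * 'D_(delta_mx 0 i) f x.
    rewrite (bigD1 K) //=; congr (_ + _); apply: eq_bigl => i.
    by rewrite ltnS ltn_neqAle andbC.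
  have small (t : R) : `|t| <= `|h 0 K| ->
      `|x + trunc k h + t *: delta_mx 0 K - x| < d.
    move=> tc; apply: le_lt_trans hd.
    have -> : x + trunc k h + t *: delta_mx 0 K - x =
        trunc k h + t *: delta_mx 0 K by rewrite [LHS]addrC !addrA addNr add0r.
    rewrite [leLHS]/Num.Def.normr /= mx_normrE; apply/bigmax_leP.
    split=> //= -[i j] _; rewrite !mxE /= (ord1 i) eqxx /=.
    have [jK|] := eqVneq j K.
      by rewrite jK ltnn add0r mulr1 (le_trans tc) ?coord_norm.
    by case: ifP => _ _; rewrite mulr0 ?addr0 ?normr0 ?normr_ge0 ?coord_norm.
  have [|t tc mvt] := @MVT_direction R _ f (x + trunc k h) (delta_mx 0 K) (h 0 K).
    by move=> t /small /near_x /(_ K)[].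
  have /(_ K)[_ dK] := near_x _ (small t tc).
  have truncSk : trunc k.+1 h = trunc k h + h 0 K *: delta_mx 0 K := truncS K h.
  rewrite sumS truncSk addrA.
  have -> : f (x + trunc k h + h 0 K *: delta_mx 0 K) - f x
      - (h 0 K * 'D_(delta_mx 0 K) f x
        + \sum_(i < n | (i < k)%N) h 0 i * 'D_(delta_mx 0 i) f x) =
      (f (x + trunc k h) - f x
        - \sum_(i < n | (i < k)%N) h 0 i * 'D_(delta_mx 0 i) f x)
      + h 0 K * ('D_(delta_mx 0 K) f (x + trunc k h + t *: delta_mx 0 K)
                 - 'D_(delta_mx 0 K) f x).
    by rewrite mulrBr -mvt; ring.
  rewrite (le_trans (ler_normD _ _))// -natr1 mulrDl mul1r lerD ?IH 1?ltnW//.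
  by rewrite normrM mulrC ler_pM ?coord_norm.
have := incr n (leqnn n).
rewrite (_ : trunc n h = h); last by apply/rowP => i; rewrite mxE ltn_ord.
rewrite (eq_bigl xpredT) => [|i]; last by rewrite ltn_ord.
move=> le1; rewrite /= !fctE /= opprD addrA [h + x]addrC.
apply: le_trans le1 _; rewrite mulrA ler_wpM2r// /eps' mulrCA ler_piMr ?ltW//.
by rewrite ltr_pdivrMr// mul1r ltr_nat.
Unshelve. all: by end_near. Qed.
End C1.

Lemma derive_line {R : realType} {V W : normedModType R} (f : V -> W) x v :
  'D_v f x = 'D_1 (fun h : R => f (h *: v + x)) 0.
Proof.
rewrite /derive; set g1 := fun h => h^-1 *: _; set g2 := fun h => h^-1 *: _.
suff -> : g1 = g2 by [].
by rewrite funeqE /g1 /g2 => h /=; rewrite addr0 scale0r add0r [_%:A]mulr1.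
Qed.

Section Chain.
Context {R : realType} {V W Z : normedModType R}.

Lemma is_derive_chain (g : W -> Z) (tau : V -> W) x v w :
  differentiable g (tau x) -> is_derive x v tau w ->
  is_derive x v (g \o tau) ('D_w g (tau x)).
Proof.
move=> dg [/derivable1P dt <-].
have dt' : differentiable (fun h : R => tau (h *: v + x)) 0.
  exact/derivable1_diffP.
have x0 : tau x = tau ((0 : R) *: v + x) by rewrite scale0r add0r.
have dgt : differentiable (g \o (fun h : R => tau (h *: v + x))) 0.
  by apply: differentiable_comp => //; rewrite -x0.
split; first exact/derivable1P/derivable1_diffP.
rewrite [LHS]derive_line -[LHS]/('D_1 (g \o (fun h : R => tau (h *: v + x))) 0).
rewrite deriveE //.
rewrite diff_comp // -?x0 //= deriveE //; congr ('d g _ _).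
by rewrite [RHS]derive_line deriveE.
Qed.

End Chain.

(** This form serves the profile phi, a function of one real variable applied
    to a function on a space of any dimension. *)
Lemma is_derive_outer {R : realType} {V : normedModType R} (phi : R -> R)
    (g : V -> R) x v (dphi dg : R) :
  is_derive (g x) 1 phi dphi -> is_derive x v g dg ->
  is_derive x v (phi \o g) (dphi * dg).
Proof.
move=> [dp dpE] dgx; have dp' : differentiable phi (g x).
  exact/derivable1_diffP.
apply: is_derive_eq; first exact: (is_derive_chain dp' dgx).
rewrite deriveE // -[dg in LHS]mulr1 [_ dg 1]/(dg *: 1) linearZ /= -deriveE //.
by rewrite dpE mulrC.
Qed.

Lemma derive_dirD {R : realType} {V W : normedModType R} (f : V -> W) x
    (t : R) u v : differentiable f x ->
  'D_(t *: u + v) f x = t *: 'D_u f x + 'D_v f x.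
Proof. by move=> df; rewrite !deriveE// linearP. Qed.

Lemma derive_dir_sum {R : realType} {V W : normedModType R} (f : V -> W) x
    (n : nat) (t : 'I_n -> R) (v : 'I_n -> V) : differentiable f x ->
  'D_(\sum_i t i *: v i) f x = \sum_i t i *: 'D_(v i) f x.
Proof.
move=> df; rewrite deriveE// linear_sum; apply: eq_bigr => i _.
by rewrite linearZ deriveE.
Qed.

Section CinftyTheory.
Context {R : realType} {V : normedModType R}.
Implicit Types (U : set V).

Lemma Cinfty_iter_derive {W : normedModType R} U (f : V -> W) s x v :
  Cinfty U f -> U x ->
  is_derive x v (iter_derive s f) (iter_derive (v :: s) f x).
Proof. by move=> /(_ s x) Cf /Cf[_ /(_ v)]; split. Qed.

(** A function is smooth as soon as a family g of functions, indexed by lists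
    of directions, behaves as the family of its iterated derivatives has to;
    the closure properties below only have to exhibit such a family. *)
Lemma Cinfty_family {W : normedModType R} U (f : V -> W)
    (g : seq V -> V -> W) : open U -> {in U, g [::] =1 f} ->
  (forall s x, U x -> {for x, continuous (g s)}) ->
  (forall s x v, U x -> is_derive x v (g s) (g (v :: s) x)) ->
  Cinfty U f.
Proof.
move=> oU g0 cg dg.
have ge s : {in U, g s =1 iter_derive s f}.
  elim: s => [//|v s IH] x xU.
  have Ux : U x by exact: set_mem.
  have [_ <-] := dg s x v Ux; apply: near_eq_derive.
  near=> z; apply: IH; apply/mem_set; near: z; exact: open_nbhs_nbhs.
have near_ge s x : U x -> \forall z \near x, g s z = iter_derive s f z.
  move=> Ux; near=> z; apply: ge; apply/mem_set; near: z.
  exact: open_nbhs_nbhs.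
move=> s x Ux; split.
  move=> A; rewrite -ge ?inE// => /(cg s x Ux) /= gA.
  have := near_ge s x Ux; rewrite /= !near_simpl => ngs.
  by near do rewrite /= -?(near ngs)//.
move=> v; apply: near_eq_derivable (near_ge s x Ux) _.
by have [] := dg s x v Ux.
Unshelve. all: by end_near. Qed.

Lemma Cinfty_eq {W : normedModType R} U (f g : V -> W) :
  open U -> {in U, f =1 g} -> Cinfty U f -> Cinfty U g.
Proof.
move=> oU fg Cf; apply: (@Cinfty_family W U g (fun s => iter_derive s f)) => //.
  by move=> s x /(Cf s)[].
by move=> s x v; exact: Cinfty_iter_derive.
Qed.

Lemma CinftyD {W : normedModType R} U (f g : V -> W) :
  open U -> Cinfty U f -> Cinfty U g -> Cinfty U (f + g).
Proof.
move=> oU Cf Cg.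
apply: (Cinfty_family (g := fun s => iter_derive s f + iter_derive s g)).
- by [].
- by [].
- by move=> s x Ux; apply: continuousD; [have [] := Cf s x Ux|have [] := Cg s x Ux].
- by move=> s x v Ux; apply: is_deriveD; apply: (@Cinfty_iter_derive _ U).
Qed.

Lemma CinftyZ {W : normedModType R} U (k : R) (f : V -> W) :
  open U -> Cinfty U f -> Cinfty U (k \*: f).
Proof.
move=> oU Cf.
apply: (Cinfty_family (g := fun s => k \*: iter_derive s f)) => //.
- move=> s x Ux; have [cf _] := Cf s x Ux.
  by apply: cvgZl_tmp; exact: cf.
- by move=> s x v Ux; apply: is_deriveZ; apply: (@Cinfty_iter_derive _ U).
Qed.

(** Each pair lists the directions in which the two factors of a product are
    differentiated in one term of its iterated derivative. *)
Fixpoint leibniz (s : seq V) : seq (seq V * seq V) :=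
  if s is v :: s' then
    [seq (v :: ab.1, ab.2) | ab <- leibniz s'] ++
    [seq (ab.1, v :: ab.2) | ab <- leibniz s']
  else [:: ([::], [::])].

Lemma CinftyM U (f g : V -> R) :
  open U -> Cinfty U f -> Cinfty U g -> Cinfty U (f * g).
Proof.
move=> oU Cf Cg.
pose G (r : seq (seq V * seq V)) : V -> R :=
  \sum_(ab <- r) iter_derive ab.1 f * iter_derive ab.2 g.
pose G' (v : V) (r : seq (seq V * seq V)) : V -> R :=
  \sum_(ab <- r) (iter_derive (v :: ab.1) f * iter_derive ab.2 g
                  + iter_derive ab.1 f * iter_derive (v :: ab.2) g).
have G'E v s : G' v (leibniz s) = G (leibniz (v :: s)).
  by rewrite /G' /G /= big_cat /= !big_map big_split.
apply: (Cinfty_family (g := fun s => G (leibniz s))) => //.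
- by rewrite /G /= big_seq1.
- move=> s x Ux; rewrite /G; elim: (leibniz s) => [|[a b] r IH].
    by rewrite big_nil; exact: cst_continuous.
  rewrite big_cons; apply: continuousD => //.
  by apply: continuousM; [have [] := Cf a x Ux|have [] := Cg b x Ux].
- move=> s x v Ux; rewrite -G'E /G /G'; elim: (leibniz s) => [|[a b] r IH].
    by rewrite !big_nil; exact: is_derive_cst.
  rewrite !big_cons; apply: is_deriveD => //=.
  have df := Cinfty_iter_derive a v Cf Ux.
  have dg := Cinfty_iter_derive b v Cg Ux.
  apply: is_derive_eq.
  by rewrite [LHS]addrC; congr (_ + _); exact: mulrC.
Qed.

Lemma Cinfty_coord n U (f : V -> 'rV[R]_n) i :
  open U -> Cinfty U f -> Cinfty U (fun x => f x 0 i : R).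
Proof.
move=> oU Cf.
apply: (Cinfty_family (g := fun s x => iter_derive s f x 0 i : R)) => //.
- move=> s x Ux; have [cf _] := Cf s x Ux.
  apply: (@continuous_comp _ _ _ (iter_derive s f) (fun M : 'rV[R]_n => M 0 i)) => //.
  exact: coord_continuous.
- move=> s x v Ux; have [df dfE] := Cinfty_iter_derive s v Cf Ux.
  rewrite -dfE derive_mx // mxE; apply: derivableP.
  by move/derivable_mxP : df.
Qed.

End CinftyTheory.

Lemma Cinfty_differentiable {R : realType} n (U : set 'rV[R]_n)
    (f : 'rV[R]_n -> R^o) x :
  open U -> Cinfty U f -> U x -> differentiable f x.
Proof.
move=> oU Cf Ux; apply: C1_differentiable => [|i].
  near=> z => i; have [|_] := Cf [::] z; last exact.
  by near: z; exact: open_nbhs_nbhs.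
by have [] := Cf [:: delta_mx 0 i] x Ux.
Unshelve. all: by end_near. Qed.

(** * The differential equations satisfied by phi *)

Section RealFunctions.
Context {R : realType}.
Implicit Types (g : R -> R) (b s : R).

Lemma cst_of_derive0 g b :
  (forall s, `|s| <= b -> is_derive s 1 g 0) ->
  forall s, `|s| <= b -> g s = g 0.
Proof.
move=> dg s sb; apply/eqP; rewrite -subr_eq0.
have [|t ts] := @MVT_direction R R g 0 1 s.
  move=> t ts; rewrite add0r [_%:A]mulr1.
  by have [] := dg t (le_trans ts sb).
rewrite !add0r ![_%:A]mulr1 => ->.
by have [_ ->] := dg t (le_trans ts sb); rewrite mulr0.
Qed.

(** The equations for phi are found only at points where some coordinate of
    the tangent vector does not vanish; continuity extends them to the whole
    range [-b, b] of beta / alpha, endpoints included. *)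
Lemma vanish_closure g b : 0 < b ->
  (forall s, `|s| <= b -> {for s, continuous g}) ->
  (forall s, 0 < `|s| < b -> g s = 0) ->
  forall s, `|s| <= b -> g s = 0.
Proof.
move=> b0 cg g0 s sb; apply/eqP/negP => /negP gs0.
have : \forall t \near s, g t != 0 by exact: cvgr_neq0 (cg s sb) gs0.
move=> /nbhs_ballP[e /= e0 ball_g].
have [t [st /g0 gt]] : exists t, ball s e t /\ 0 < `|t| < b.
  rewrite /ball /=; have [s0|s0|->] := ltgtP s 0.
  - pose m := Num.min e (- s); exists (s + m / 2).
    have m0 : 0 < m by rewrite lt_min e0 oppr_gt0.
    have me : m <= e by rewrite ge_min lexx.
    have ms : m <= - s by rewrite ge_min lexx orbT.
    rewrite ltr0_norm in sb => //.
    rewrite opprD addrA subrr sub0r normrN gtr0_norm ?divr_gt0//.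
    rewrite [`|s + _|]ltr0_norm; last by lra.
    by split; [lra | apply/andP; split; lra].
  - pose m := Num.min e s; exists (s - m / 2).
    have m0 : 0 < m by rewrite lt_min e0.
    have me : m <= e by rewrite ge_min lexx.
    have ms : m <= s by rewrite ge_min lexx orbT.
    rewrite gtr0_norm in sb => //.
    rewrite opprB addrC subrK gtr0_norm ?divr_gt0//.
    rewrite [`|s - _|]gtr0_norm; last by lra.
    by split; [lra | apply/andP; split; lra].
  - pose m := Num.min e b; exists (m / 2).
    have m0 : 0 < m by rewrite lt_min e0.
    have me : m <= e by rewrite ge_min lexx.
    have mb : m <= b by rewrite ge_min lexx orbT.
    rewrite sub0r normrN gtr0_norm ?divr_gt0//.
    by split; [lra | apply/andP; split; lra].
by have := ball_g t st; rewrite /= gt eqxx.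
Qed.

End RealFunctions.

(** These are the profiles of Randers metrics: with them alpha phi(beta/alpha)
    equals sqrt(k1 alpha^2 + k2 beta^2) + k3 beta. *)
Definition randers_function {R : realType} (phi : R -> R) (b : R) :=
  exists k1 k2 k3 : R, 0 < k1 /\ forall s, `|s| <= b ->
    0 < k1 + k2 * s ^+ 2 /\ phi s = Num.sqrt (k1 + k2 * s ^+ 2) + k3 * s.

Section Profile.
Context {R : realType}.
Implicit Types s : R.
Variables (phi phi1 phi2 : R -> R) (b b0 : R).
Hypothesis b_ge0 : 0 <= b.
Hypothesis b_lt : b < b0.
Hypothesis dphi : forall s, `|s| < b0 -> is_derive s 1 phi (phi1 s).
Hypothesis dphi1 : forall s, `|s| < b0 -> is_derive s 1 phi1 (phi2 s).
Hypothesis cphi2 : forall s, `|s| < b0 -> {for s, continuous phi2}.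
(* A and D are the two quantities that convexity makes positive; A is also the
   derivative of alpha phi(beta/alpha) with respect to alpha. *)
Let A : R -> R := phi - id * phi1.
Let D : R -> R := A + (cst (b ^+ 2) - id * id) * phi2.
Hypothesis phi_gt0 : forall s, `|s| <= b -> 0 < phi s.
Hypothesis A_gt0 : forall s, `|s| <= b -> 0 < A s.
Hypothesis D_gt0 : forall s, `|s| <= b -> 0 < D s.

Let le_lt s : `|s| <= b -> `|s| < b0. Proof. by move/le_lt_trans; apply. Qed.

Let dA s : `|s| < b0 -> is_derive s 1 A (- (s * phi2 s)).
Proof.
move=> sb; have d0 := dphi sb; have d1 := dphi1 sb.
apply: is_derive_eq; rewrite /GRing.scale /= mulr1; ring.
Qed.

Let contD (f g : R -> R) s : {for s, continuous f} ->
  {for s, continuous g} -> {for s, continuous (f + g)}.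
Proof. by move=> cf cg; exact: continuousD. Qed.

Let contB (f g : R -> R) s : {for s, continuous f} ->
  {for s, continuous g} -> {for s, continuous (f - g)}.
Proof. by move=> cf cg; exact: continuousB. Qed.

Let contM (f g : R -> R) s : {for s, continuous f} ->
  {for s, continuous g} -> {for s, continuous (f * g)}.
Proof. by move=> cf cg; exact: continuousM. Qed.

Let cont_cst (k : R) s : {for s, continuous (cst k : R -> R)}.
Proof. exact: cst_continuous. Qed.

Let cont_sqr s : {for s, continuous (id * id : R -> R)}.
Proof. by apply: contM; exact: cvg_id. Qed.

Let derive_cont (f : R -> R) s df : is_derive s 1 f df -> {for s, continuous f}.
Proof. by move=> [df' _]; apply/differentiable_continuous/derivable1_diffP. Qed.

Let cont s : `|s| <= b -> [/\ {for s, continuous phi}, {for s, continuous phi1},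
  {for s, continuous phi2} & {for s, continuous A}].
Proof.
by move=> /le_lt sb; split; [exact: derive_cont (dphi sb)
  | exact: derive_cont (dphi1 sb) | exact: cphi2 | exact: derive_cont (dA sb)].
Qed.

(** With W = 1 - psi (b^2 - s^2) the equation reads phi'' W = psi A. As
    A' = -s phi'' and W' = 2 psi s, both A^2 W and phi' - (psi / W(0)) s A are
    constant. The first gives A up to a square root of W, the second gives phi',
    and phi = A + s phi'. *)
Lemma randers_function_of_ode psi :
  (forall s, `|s| <= b -> phi2 s = psi * D s) -> randers_function phi b.
Proof.
move=> ode; pose W : R -> R := cst (1 - psi * b ^+ 2) + cst psi * (id * id).
have WE s : W s = 1 - psi * b ^+ 2 + psi * s ^+ 2 by rewrite expr2.
have DE s : D s = A s + (b ^+ 2 - s ^+ 2) * phi2 s by rewrite expr2.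
have DW s : `|s| <= b -> D s * W s = A s.
  by move=> sb; rewrite WE; have := ode s sb; rewrite DE; nra.
have W_gt0 s : `|s| <= b -> 0 < W s.
  by move=> sb; rewrite -(pmulr_rgt0 _ (D_gt0 sb)) DW// A_gt0.
have phi2W s : `|s| <= b -> phi2 s * W s = psi * A s.
  by move=> sb; rewrite -DW// ode//; ring.
have norm0 : `|0 : R| <= b by rewrite normr0.
pose W0 := W 0; have W0E : W0 = 1 - psi * b ^+ 2 by rewrite /W0 WE; ring.
have W0_gt0 : 0 < W0 := W_gt0 0 norm0.
have AAW s : `|s| <= b -> (A * A * W) s = (A * A * W) 0.
  apply: cst_of_derive0 => {}s sb; have dAs := dA (le_lt sb).
  have dW : is_derive s 1 W (psi * (s + s)).
    apply: (is_derive_eq (is_deriveD (is_derive_cst _ s 1) (is_deriveM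
      (is_derive_cst psi s 1) (is_deriveM (is_derive_id s 1) (is_derive_id s 1))))).
    by rewrite /GRing.scale /= !mulr1 mulr0 addr0 add0r.
  apply: (is_derive_eq (is_deriveM (is_deriveM dAs dAs) dW)).
  rewrite /GRing.scale /= !fctE /=.
  transitivity (2 * s * A s * (psi * A s - phi2 s * W s)); first by ring.
  by rewrite phi2W// subrr mulr0.
pose L : R -> R := phi1 - cst (psi / W0) * (id * A).
have L0 s : `|s| <= b -> L s = L 0.
  apply: cst_of_derive0 => {}s sb; have dAs := dA (le_lt sb).
  have d1 := dphi1 (le_lt sb).
  apply: is_derive_eq; rewrite /GRing.scale /= !fctE /= !mulr0 !mulr1.
  have W0n : W0 != 0 by rewrite gt_eqF.
  transitivity (phi2 s * (W0 + psi * s ^+ 2 - W s) / W0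
                + (phi2 s * W s - psi * A s) / W0); first by field.
  by rewrite phi2W// subrr WE W0E subrr mulr0 !mul0r addr0.
have phiE s : phi s = A s + s * phi1 s by rewrite /A !fctE /= subrK.
exists (A 0 ^+ 2), (psi * A 0 ^+ 2 / W0), (L 0); split.
  by rewrite exprn_gt0 ?A_gt0.
move=> s sb; have KE : A 0 ^+ 2 + psi * A 0 ^+ 2 / W0 * s ^+ 2 =
   (A s * W s / W0) ^+ 2.
  have W0n : W0 != 0 by rewrite gt_eqF.
  have -> : (A s * W s / W0) ^+ 2 = (A * A * W) s * W s / W0 ^+ 2.
    by rewrite !fctE /=; field.
  by rewrite AAW// WE -W0E !fctE /= -/W0; field.
have AW_gt0 : 0 < A s * W s / W0.
  by rewrite divr_gt0// mulr_gt0// ?A_gt0// W_gt0.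
rewrite KE sqrtr_sqr gtr0_norm// exprn_gt0//; split=> //.
rewrite -(L0 s sb) phiE /L !fctE /= WE -W0E; field.
by rewrite gt_eqF.
Qed.

(** Differentiating phi' = c s A gives phi'' (1 + c s^2) = c A, which is the
    equation phi'' = psi D for psi = c / (1 + c b^2); the denominator is
    phi(b) / A(b), hence positive. *)
Lemma randers_function_of_odd_linear c : 0 < b ->
  (forall s, 0 < `|s| < b -> phi1 s = c * s * A s) -> randers_function phi b.
Proof.
move=> b0' odd.
have odd' s : `|s| <= b -> phi1 s = c * s * A s.
  move=> sb; apply/eqP; rewrite -subr_eq0; apply/eqP.
  apply: (@vanish_closure _ (phi1 - cst c * id * A) b b0' _ _ s sb) => {sb}s.
    move=> /cont[_ c1 _ cA]; apply: contB c1 (contM (contM _ _) cA).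
      exact: cont_cst.
    exact: cvg_id.
  by move=> /odd e; rewrite !fctE /= e subrr.
have lin s : `|s| <= b -> phi2 s * (1 + c * s ^+ 2) = c * A s.
  move=> sb; apply/eqP; rewrite -subr_eq0; apply/eqP.
  rewrite -[LHS]/((fun s => phi2 s * (1 + c * s ^+ 2) - c * A s) s).
  rewrite (_ : (fun s => _) = phi2 * (cst 1 + cst c * (id * id)) - cst c * A);
    last by apply/funext => t; rewrite !fctE expr2.
  apply: (@vanish_closure _ (phi2 * (cst 1 + cst c * (id * id)) - cst c * A) b
    b0' _ _ s sb) => {sb}s.
    move=> /cont[_ _ c2 cA].
    exact: contB (contM c2 (contD (@cont_cst _ _) (contM (@cont_cst _ _)
      (@cont_sqr _)))) (contM (@cont_cst _ _) cA).
  move=> /andP[s0 sb].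
  have dL : is_derive s 1 (phi1 - cst c * id * A) 0.
    apply: near_eq_is_derive (is_derive_cst 0 s 1).
    near=> t; rewrite !fctE /= odd' ?subrr//; apply/ltW; near: t.
    by apply: (@cvgr_norm_lt _ _ _ _ _ id s); first exact: cvg_id.
  have dAs := dA (le_lt (ltW sb)); have d1 := dphi1 (le_lt (ltW sb)).
  have [_ dL0] := dL; rewrite -[RHS]dL0.
  suff [_ ->] : is_derive s 1 (phi1 - cst c * id * A)
      ((phi2 * (cst 1 + cst c * (id * id)) - cst c * A) s) by [].
  clear dL dL0; apply: is_derive_eq; rewrite /GRing.scale /= !fctE /= !mulr1; ring.
have normb : `|b| <= b by rewrite ger0_norm.
have cb : 0 < 1 + c * b ^+ 2.
  have := phi_gt0 normb.
  have -> : phi b = A b * (1 + c * b ^+ 2).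
    have -> : phi b = A b + b * phi1 b by rewrite /A !fctE /= subrK.
    by rewrite odd'//; ring.
  by rewrite pmulr_rgt0// A_gt0.
apply: (@randers_function_of_ode (c / (1 + c * b ^+ 2))) => s sb.
have -> : D s = A s + (b ^+ 2 - s ^+ 2) * phi2 s by rewrite expr2.
rewrite mulrAC; apply/(canRL (mulfK _)); first by rewrite gt_eqF.
by rewrite [RHS]mulrDr -lin//; ring.
Unshelve. all: by end_near. Qed.

(** By continuity the hypothesis extends to s = b, where it reads
    D c1 b^2 = sigma A with D = A; hence c1 = sigma / b^2. What is left is
    divisible by b^2 - s^2, and the quotient is an equation phi'' = psi D with
    psi constant. *)
Lemma randers_function_of_quotient sigma c1 c3 : 0 < b -> sigma != 0 ->
  (forall s, `|s| < b ->
    D s * (c1 * s ^+ 2 + c3 * (1 - s ^+ 2 / b ^+ 2)) = sigma * A s) ->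
  randers_function phi b.
Proof.
move=> b0' sn quot.
have DE s : D s = A s + (b ^+ 2 - s ^+ 2) * phi2 s by rewrite expr2.
have cD s : `|s| <= b -> {for s, continuous D}.
  move=> /cont[_ _ c2 cA].
  exact: contD cA (contM (contB (@cont_cst _ _) (@cont_sqr _)) c2).
have quot' s : `|s| <= b ->
    D s * (c1 * s ^+ 2 + c3 * (1 - s ^+ 2 / b ^+ 2)) = sigma * A s.
  move=> sb; apply/eqP; rewrite -subr_eq0; apply/eqP.
  pose f : R -> R := D * (cst c1 * (id * id)
     + cst c3 * (cst 1 - cst (b ^+ 2)^-1 * (id * id))) - cst sigma * A.
  transitivity (f s); first by rewrite /f !fctE /= -expr2; ring.
  apply: (@vanish_closure _ f b b0' _ _ s sb) => {sb}s.
    move=> sb; have [_ _ _ cA] := cont sb.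
    exact: contB (contM (cD s sb) (contD (contM (@cont_cst _ _) (@cont_sqr _))
      (contM (@cont_cst _ _) (contB (@cont_cst _ _)
        (contM (@cont_cst _ _) (@cont_sqr _)))))) (contM (@cont_cst _ _) cA).
  move=> /andP[_ sb]; apply/eqP; rewrite subr_eq0 /= !fctE /=; apply/eqP.
  by rewrite -quot// -!expr2 [(b ^+ 2)^-1 * _]mulrC.
have normb : `|b| <= b by rewrite ger0_norm.
have b2 : b ^+ 2 != 0 by rewrite expf_neq0// gt_eqF.
have c1E : c1 = sigma / b ^+ 2.
  have := quot' b normb; rewrite DE subrr mul0r addr0 divff// subrr mulr0 addr0.
  rewrite mulrC => /mulIf; rewrite gt_eqF ?A_gt0// => /(_ isT) <-.
  by rewrite mulfK.
apply: (@randers_function_of_ode ((sigma - c3) / (sigma * b ^+ 2))) => s sb.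
apply/eqP; rewrite -subr_eq0; apply/eqP.
set psi := (_ / _).
apply: (@vanish_closure _ (phi2 - cst psi * D) b b0' _ _ s sb) => {sb}s.
  move=> sb; have [_ _ c2 _] := cont sb.
  exact: contB c2 (contM (@cont_cst _ _) (cD s sb)).
move=> /andP[_ sb]; rewrite !fctE /=.
have sb2 : b ^+ 2 - s ^+ 2 != 0.
  rewrite subr_eq0 eq_sym -[s ^+ 2]real_normK ?num_real// eqrXn2//.
  by rewrite lt_eqF.
have := quot s sb; rewrite c1E.
have -> : A s = D s - (b ^+ 2 - s ^+ 2) * phi2 s by rewrite DE addrK.
move=> e; apply: (mulIf (mulf_neq0 sn sb2)); rewrite mul0r.
have -> : (phi2 s - psi * D s) * (sigma * (b ^+ 2 - s ^+ 2)) =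
  D s * (sigma / b ^+ 2 * s ^+ 2 + c3 * (1 - s ^+ 2 / b ^+ 2))
  - sigma * (D s - (b ^+ 2 - s ^+ 2) * phi2 s).
  by rewrite /psi; field; rewrite sn gt_eqF.
by rewrite e subrr.
Qed.

End Profile.

(** * Euclidean algebra *)

(** Reduces an equation that follows from another one to an identity of
    polynomials or fractions. *)
Lemma eq_by_sub {R : zmodType} (x y z t : R) : z = t -> x - y = z - t -> x = y.
Proof. by move=> -> /eqP; rewrite subrr subr_eq0 => /eqP. Qed.

Section Dot.
Context {R : realType} {n : nat}.
Implicit Types (u v w : 'rV[R]_n) (t : R).

Definition dot u v : R := \sum_i u 0 i * v 0 i.

Lemma dotC u v : dot u v = dot v u.
Proof. by apply: eq_bigr => i _; rewrite mulrC. Qed.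

Lemma dotDl u v w : dot (u + v) w = dot u w + dot v w.
Proof. by rewrite -big_split; apply: eq_bigr => i _; rewrite mxE mulrDl. Qed.

Lemma dotZl t u w : dot (t *: u) w = t * dot u w.
Proof. by rewrite /dot mulr_sumr; apply: eq_bigr => i _; rewrite mxE mulrA. Qed.

Lemma dotDr u v w : dot w (u + v) = dot w u + dot w v.
Proof. by rewrite dotC dotDl !(dotC w). Qed.

Lemma dotZr t u w : dot w (t *: u) = t * dot w u.
Proof. by rewrite dotC dotZl dotC. Qed.

Lemma dot0r w : dot w 0 = 0.
Proof. by rewrite -[0 in LHS](scale0r w) dotZr mul0r. Qed.

Lemma dot0l w : dot 0 w = 0.
Proof. by rewrite dotC dot0r. Qed.

Lemma dotNl u w : dot (- u) w = - dot u w.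
Proof. by rewrite -scaleN1r dotZl mulN1r. Qed.

Lemma dotNr u w : dot w (- u) = - dot w u.
Proof. by rewrite dotC dotNl dotC. Qed.

Lemma dot_ge0 u : 0 <= dot u u.
Proof. by apply: sumr_ge0 => i _; rewrite -expr2 sqr_ge0. Qed.

Lemma dot_eq0 u : (dot u u == 0) = (u == 0).
Proof.
apply/eqP/eqP => [u0|->]; last by rewrite dot0l.
apply/rowP => i; rewrite mxE; apply/eqP; rewrite -sqrf_eq0 expr2.
have := @psumr_eq0P _ _ xpredT (fun i => u 0 i * u 0 i) _ u0 i erefl.
by move=> -> // j _; rewrite -expr2 sqr_ge0.
Qed.

Lemma dot_gt0 u : u != 0 -> 0 < dot u u.
Proof. by move=> u0; rewrite lt_def dot_eq0 u0 dot_ge0. Qed.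

Lemma dot_CS u v : dot u v ^+ 2 <= dot u u * dot v v.
Proof.
have [->|u0] := eqVneq u 0.
  by rewrite !dot0l expr0n mul0r.
(* This vector is |u|^2 times the part of v orthogonal to u. *)
have := dot_ge0 (dot u u *: v - dot u v *: u).
rewrite !(dotDl, dotDr, dotNl, dotNr, dotZl, dotZr) (dotC v u).
have := dot_gt0 u0; set a := dot u u; set c := dot u v; set d := dot v v.
move=> a0 h; rewrite -subr_ge0 -(pmulr_rge0 _ a0).
by apply: le_trans h _; rewrite le_eqVlt; apply/orP; left; apply/eqP; ring.
Qed.

Lemma exists_unit u : u != 0 ->
  exists w t, [/\ t != 0, w = t *: u & dot w w = 1].
Proof.
move=> /dot_gt0 u2; exists ((Num.sqrt (dot u u))^-1 *: u), (Num.sqrt (dot u u))^-1.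
split=> //; first by rewrite invr_neq0// gt_eqF// sqrtr_gt0.
rewrite dotZl dotZr mulrA -invfM -expr2 sqr_sqrtr ?ltW// mulVf// gt_eqF//.
Qed.

Lemma exists_orthogonal u v : (2 < n)%N ->
  exists w, [/\ dot w w = 1, dot u w = 0 & dot v w = 0].
Proof.
move=> n2; pose M : 'M[R]_(n, 2) := \matrix_(i, j) if j == 0 then u 0 i else v 0 i.
have ker0 : kermx M != 0.
  rewrite -mxrank_eq0 mxrank_ker subn_eq0 -ltnNge.
  exact: leq_ltn_trans (rank_leq_col M) n2.
have /rowV0Pn[w /sub_kermxP wM w0] := ker0.
have orth (x : 'rV[R]_n) (j : 'I_2) : (forall i, M i j = x 0 i) -> dot x w = 0.
  move=> Mx; rewrite dotC /dot.
  transitivity ((w *m M) 0 j); last by rewrite wM mxE.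
  by rewrite mxE; apply: eq_bigr => i _; rewrite Mx.
have uw : dot u w = 0 by apply: (orth _ 0) => i; rewrite mxE.
have vw : dot v w = 0 by apply: (orth _ 1) => i; rewrite mxE.
have [w1 [t [_ w1E w11]]] := exists_unit w0.
by exists w1; split=> //; rewrite w1E dotZr ?uw ?vw mulr0.
Qed.

End Dot.

Lemma dot_delta {R : realType} n (u : 'rV[R]_n) i : dot u (delta_mx 0 i) = u 0 i.
Proof.
rewrite /dot (bigD1 i)//= mxE !eqxx mulr1 big1 ?addr0// => j /negPf ji.
by rewrite mxE ji andbF mulr0.
Qed.

Lemma dot_mulmx {R : realType} n m (y : 'rV[R]_n) (z : 'rV[R]_m) (K : 'M[R]_(n, m)) :
  dot (y *m K) z = dot y (z *m K^T).
Proof.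
rewrite /dot; under eq_bigr do rewrite mxE mulr_suml.
rewrite exchange_big; apply: eq_bigr => i _ /=.
rewrite mxE mulr_sumr; apply: eq_bigr => j _.
by rewrite mxE -mulrA [K i j * _]mulrC.
Qed.

(** * Solving Hamel's equation on two-dimensional planes *)

(** Only the restrictions to planes matter, so being quadratic is expressed by
    them. *)
Definition quadratic_map {R : realType} {n : nat} (q : 'rV[R]_n -> 'rV[R]_n) :=
  forall x y, exists c0 c1 c2, forall s r : R,
    q (s *: x + r *: y) = s ^+ 2 *: c0 + (s * r) *: c1 + r ^+ 2 *: c2.

Section Alternating.
Context {R : realType} {V : lmodType R} (br : V -> V -> V).
Hypothesis brDl : forall t u v w, br (t *: u + v) w = t *: br u w + br v w.
Hypothesis brDr : forall t u v w, br w (t *: u + v) = t *: br w u + br w v.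
Hypothesis br_alt : forall u, br u u = 0.

Lemma alternating0l w : br 0 w = 0.
Proof. by have := brDl (-1) 0 0 w; rewrite scaler0 addr0 scaleN1r addNr. Qed.

Lemma alternating0r w : br w 0 = 0.
Proof. by have := brDr (-1) 0 0 w; rewrite scaler0 addr0 scaleN1r addNr. Qed.

Lemma alternatingZl t u w : br (t *: u) w = t *: br u w.
Proof. by have := brDl t u 0 w; rewrite alternating0l !addr0. Qed.

Lemma alternatingZr t u w : br w (t *: u) = t *: br w u.
Proof. by have := brDr t u 0 w; rewrite alternating0r !addr0. Qed.

Lemma alternatingC u w : br u w = - br w u.
Proof.
apply/eqP; rewrite -subr_eq0 opprK; apply/eqP.
have := br_alt (1 *: u + w); rewrite brDl !brDr !br_alt !scale1r.
by rewrite add0r addr0 addrC.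
Qed.

End Alternating.

(** In this section xi is the vector dual to beta, br is a Lie bracket and
    [hamel] is the equation D^2 f(u)(gam u, w) = - Df(u)(br u w) for
    f(u) = |u| phi(<xi,u>/|u|), written out for |u| = 1. The 2-form dbeta is, up
    to sign, <xi, br u w>. *)
Section Hamel.
Context {R : realType} {n : nat}.
Variables (phi phi1 phi2 : R -> R) (b b0 : R).
Hypothesis b_gt0 : 0 < b.
Hypothesis b_lt : b < b0.
Hypothesis dphi : forall s : R, `|s| < b0 -> is_derive s 1 phi (phi1 s).
Hypothesis dphi1 : forall s : R, `|s| < b0 -> is_derive s 1 phi1 (phi2 s).
Hypothesis cphi2 : forall s : R, `|s| < b0 -> {for s, continuous phi2}.
Hypothesis phi_gt0 : forall s, `|s| <= b -> 0 < phi s.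
Hypothesis A_gt0 : forall s, `|s| <= b -> 0 < phi s - s * phi1 s.
Hypothesis D_gt0 : forall s, `|s| <= b ->
  0 < phi s - s * phi1 s + (b ^+ 2 - s ^+ 2) * phi2 s.
Variables (xi : 'rV[R]_n) (br : 'rV[R]_n -> 'rV[R]_n -> 'rV[R]_n)
  (gam : 'rV[R]_n -> 'rV[R]_n).
Hypothesis xi2 : dot xi xi = b ^+ 2.
Hypothesis brDl : forall t u v w, br (t *: u + v) w = t *: br u w + br v w.
Hypothesis brDr : forall t u v w, br w (t *: u + v) = t *: br w u + br w v.
Hypothesis br_alt : forall u, br u u = 0.
Hypothesis gam_quad : quadratic_map gam.
Hypothesis hamel : forall u, dot u u = 1 -> forall w, let s := dot xi u in
  (phi s - s * phi1 s) * (dot (gam u) w - dot u (gam u) * dot u w)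
  + phi2 s * (dot xi (gam u) - s * dot u (gam u)) * (dot xi w - s * dot u w)
  = - ((phi s - s * phi1 s) * dot u (br u w) + phi1 s * dot xi (br u w)).

Let A s := phi s - s * phi1 s.

Let br0l w : br 0 w = 0 := alternating0l brDl w.
Let br0r w : br w 0 = 0 := alternating0r brDr w.
Let brZl t u w : br (t *: u) w = t *: br u w := alternatingZl brDl t u w.
Let brZr t u w : br w (t *: u) = t *: br w u := alternatingZr brDr t u w.
Let brC u w : br u w = - br w u := alternatingC brDl brDr br_alt u w.

(* When nu is a unit vector orthogonal to xi, <xi, plane nu s r> = s, so the
   two unit vectors with a given s differ by the sign of r only. *)
Let plane nu s r : 'rV[R]_n := (s / b ^+ 2) *: xi + r *: nu.

Let b2n : b ^+ 2 != 0. Proof. by rewrite expf_neq0// gt_eqF. Qed.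

Section Plane.
Variable nu : 'rV[R]_n.
Hypothesis nu2 : dot nu nu = 1.
Hypothesis xinu : dot xi nu = 0.

Let xi_plane s r : dot xi (plane nu s r) = s.
Proof. by rewrite dotDr !dotZr xinu xi2 mulr0 addr0 divfK. Qed.

Let plane2 s r : r ^+ 2 = 1 - s ^+ 2 / b ^+ 2 ->
  dot (plane nu s r) (plane nu s r) = 1.
Proof.
move=> r2; rewrite {1}/plane dotDl !dotZl xi_plane dotDr !dotZr nu2 mulr1.
by rewrite (dotC nu) xinu mulr0 add0r -expr2 r2; field; rewrite gt_eqF.
Qed.

Let rho s := Num.sqrt (1 - s ^+ 2 / b ^+ 2).

Let rho2 s : `|s| <= b -> rho s ^+ 2 = 1 - s ^+ 2 / b ^+ 2.
Proof.
move=> sb; rewrite sqr_sqrtr// subr_ge0 ler_pdivrMr ?exprn_gt0// mul1r.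
by rewrite -[s ^+ 2]real_normK ?num_real// ler_pXn2r// nnegrE ltW.
Qed.

Let rho_gt0 s : `|s| < b -> 0 < rho s.
Proof.
move=> sb; rewrite sqrtr_gt0 subr_gt0 ltr_pdivrMr ?exprn_gt0// mul1r.
by rewrite -[s ^+ 2]real_normK ?num_real// ltr_pXn2r// nnegrE ltW.
Qed.

(** Pairing Hamel's equation with v, which is orthogonal to the plane, removes
    phi'' and leaves
      A (c0 s^2 + c1 s r + c2 r^2) = - phi' (kappa s + lam r)
    for r = rho and for r = - rho. If kappa is not zero, the even part in r
    gives phi' = - (c0 / kappa) s A, where c2 = 0 comes from s = 0; otherwise
    the odd part gives phi' = - (c1 / lam) s A. *)
Lemma randers_function_of_dbeta_plane v : dot xi v = 0 -> dot nu v = 0 ->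
  dot xi (br xi v) != 0 \/ dot xi (br nu v) != 0 -> randers_function phi b.
Proof.
move=> xiv nuv nonclosed.
pose kappa := dot xi (br xi v) / b ^+ 2; pose lam := dot xi (br nu v).
have [c0 [c1 [c2 cE]]] : exists c0 c1 c2, forall s r,
    `|s| <= b -> r ^+ 2 = 1 - s ^+ 2 / b ^+ 2 ->
    A s * (c0 * s ^+ 2 + c1 * (s * r) + c2 * r ^+ 2)
    = - phi1 s * (kappa * s + lam * r).
  have [d0 [d1 [d2 dE]]] := gam_quad xi nu.
  exists ((dot d0 v + dot xi (br xi v)) / b ^+ 2 ^+ 2),
    ((dot d1 v + dot xi (br nu v) + dot nu (br xi v)) / b ^+ 2),
    (dot d2 v + dot nu (br nu v)) => s r sb r2.
  have := hamel (plane2 r2) v; rewrite /= xi_plane xiv.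
  have -> : dot (plane nu s r) v = 0 by rewrite dotDl !dotZl xiv nuv !mulr0 addr0.
  rewrite !mulr0 !subr0 mulr0 addr0 /plane dE brDl brZl.
  rewrite !(dotDl, dotDr, dotZl, dotZr) => e.
  by apply: (eq_by_sub e); rewrite /kappa /lam /A; field; rewrite gt_eqF.
have norm0 : `|0 : R| <= b by rewrite normr0 ltW.
have rho0 : rho 0 = 1 by rewrite /rho expr0n mul0r subr0 sqrtr1.
have nsq s : `|s| <= b -> (- rho s) ^+ 2 = 1 - s ^+ 2 / b ^+ 2.
  by rewrite sqrrN; exact: rho2.
apply: (@randers_function_of_odd_linear _ phi phi1 phi2 b b0 (ltW b_gt0) b_lt dphi dphi1 cphi2
  phi_gt0 A_gt0 _ (if kappa != 0 then - c0 / kappa else - c1 / lam) b_gt0).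
  by move=> s /D_gt0; rewrite !fctE /= expr2.
move=> s /andP[s0 sb]; rewrite normr_gt0 in s0.
have eP := cE s (rho s) (ltW sb) (rho2 (ltW sb)).
have eN := cE s (- rho s) (ltW sb) (nsq s (ltW sb)).
have [kappa0|kappan] := eqVneq kappa 0.
  have lamn : lam != 0.
    case: nonclosed => // k0; case/negP: k0.
    by move/eqP: kappa0; rewrite mulf_eq0 invr_eq0 (negPf b2n) orbF.
  have rs0 : 2 * rho s != 0 by rewrite mulf_neq0 ?gt_eqF ?rho_gt0.
  apply: (mulfI (mulf_neq0 lamn rs0)).
  apply: (eq_by_sub (esym (congr2 (fun x y => y - x) eP eN))).
  by rewrite kappa0 !fctE /= -/(A s); field.
have c20 : c2 = 0.
  have := cE 0 (rho 0) norm0 (rho2 norm0).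
  have := cE 0 (- rho 0) norm0 (nsq 0 norm0).
  rewrite rho0 => e1 e2; apply: (mulfI (mulf_neq0 _ _ : 2 * A 0 != 0)).
    by [].
    by rewrite gt_eqF// /A; apply: A_gt0.
  by apply: (eq_by_sub (congr2 (fun x y => y + x) e1 e2)); ring.
apply: (mulfI (mulf_neq0 kappan (mulf_neq0 s0 _ : s * 2 != 0))) => //.
apply: (eq_by_sub (esym (congr2 (fun x y => - (x + y)) eP eN))).
by rewrite c20 !fctE /= -/(A s); field.
Qed.

(** Here Hamel's equation is paired with w = r xi - s nu, the direction of the
    plane orthogonal to u. Since xi - s u = r w and br u w = - br xi nu, it
    becomes D <gam u, w> = sigma A r; the left factor is a cubic form in (s, r)
    whose odd part in r is r (c1 s^2 + c3 r^2). *)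
Lemma randers_function_of_dbeta_eq0 : (forall u w, dot xi (br u w) = 0) ->
  dot nu (br xi nu) != 0 -> randers_function phi b.
Proof.
move=> closed sn; set sigma := dot nu (br xi nu) in sn.
have [d0 [d1 [d2 dE]]] := gam_quad xi nu.
have eq_plane s r : `|s| <= b -> r ^+ 2 = 1 - s ^+ 2 / b ^+ 2 ->
    (A s + (b ^+ 2 - s ^+ 2) * phi2 s) * dot (gam (plane nu s r)) (r *: xi - s *: nu)
    = A s * r * sigma.
  move=> sb r2; have := hamel (plane2 r2) (r *: xi - s *: nu).
  rewrite /= xi_plane !closed; set u := plane nu s r; set w := r *: xi - s *: nu.
  have uw : dot u w = 0.
    rewrite /w dotDr dotNr !dotZr (dotC u xi) xi_plane (dotC u nu) /u /plane.
    by rewrite dotDr !dotZr (dotC nu xi) xinu nu2; ring.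
  have xiw : dot xi w = r * b ^+ 2.
    by rewrite /w dotDr dotNr !dotZr xinu xi2; ring.
  have gw : dot xi (gam u) - s * dot u (gam u) = r * dot (gam u) w.
    rewrite /w !dotDr dotNr !dotZr {2}/u /plane dotDl !dotZl.
    rewrite (dotC (gam u) xi) (dotC (gam u) nu).
    apply: (eq_by_sub (congr1 (fun x => - dot xi (gam u) * x) r2)).
    by field; rewrite gt_eqF.
  have brw : br u w = - br xi nu.
    have e1 : br xi w = - s *: br xi nu.
      by rewrite /w -scaleNr addrC brDr brZr br_alt scaler0 addr0.
    have e2 : br nu w = - r *: br xi nu.
      by rewrite /w -scaleNr brDr brZr br_alt scaler0 addr0 brC scalerN scaleNr.
    rewrite /u /plane brDl brZl e1 e2 !scalerA -scalerDl -[RHS]scaleN1r.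
    congr (_ *: _); apply: (eq_by_sub (congr1 (fun x => - x) r2)).
    by field; rewrite gt_eqF.
  have ubr : dot u (br u w) = - (r * sigma).
    by rewrite brw dotNr /u /plane dotDl !dotZl closed; rewrite mulr0 add0r.
  rewrite uw gw ubr xiw !mulr0 !subr0 => e.
  apply: (eq_by_sub e); apply: (eq_by_sub
    (congr1 (fun x => - phi2 s * dot (gam u) w * b ^+ 2 * x) r2)).
  by rewrite /A; field; rewrite gt_eqF.
(* The coefficients of s^2 r and of r^3 in <gam u, w>. *)
pose c1 := dot d0 xi / b ^+ 2 ^+ 2 - dot d1 nu / b ^+ 2 : R.
pose c3 := dot d2 xi : R.
have rs s : `|s| < b -> 2 * rho s != 0.
  by move=> sb; rewrite mulf_neq0 ?gt_eqF ?rho_gt0.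
apply: (@randers_function_of_quotient _ phi phi1 phi2 b b0 (ltW b_gt0) b_lt dphi
  dphi1 cphi2 _ _ sigma c1 c3 b_gt0 sn).
- by move=> s /A_gt0.
- by move=> s /D_gt0; rewrite !fctE /= expr2.
move=> s sb; have eP := eq_plane s (rho s) (ltW sb) (rho2 (ltW sb)).
have nsq : (- rho s) ^+ 2 = 1 - s ^+ 2 / b ^+ 2 by rewrite sqrrN rho2// ltW.
have eN := eq_plane s (- rho s) (ltW sb) nsq.
rewrite !fctE /= -rho2 ?ltW// -expr2 -/(A s).
apply: (mulfI (rs s sb)).
move: eP eN; rewrite /plane !dE !(dotDl, dotDr, dotNl, dotNr, dotZl, dotZr).
move=> eP eN; apply: (eq_by_sub (congr2 (fun x y => x - y) eP eN)).
by rewrite /c1 /c3; field; rewrite gt_eqF.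
Qed.
End Plane.

(** A plane and a vector v as above are found by orthogonal projection. If some
    <xi, br xi v> is not zero, v can be made orthogonal to xi without changing
    this number, and any nu orthogonal to both will do; otherwise both arguments
    of dbeta can be made orthogonal to xi without changing its value. *)
Lemma randers_function_of_dbeta_neq0 u w : (2 < n)%N -> dot xi (br u w) != 0 ->
  randers_function phi b.
Proof.
move=> n2 uw.
have xi_perp v : dot xi (v - (dot xi v / b ^+ 2) *: xi) = 0.
  by rewrite dotDr dotNr dotZr xi2; field; rewrite gt_eqF.
have [[v xiv]|noxi] := pselect (exists v, dot xi (br xi v) != 0).
  pose v' := v - (dot xi v / b ^+ 2) *: xi.
  have [nu [nu2 nuxi nuv]] := exists_orthogonal xi v' n2.
  apply: (@randers_function_of_dbeta_plane nu nu2 nuxi v' (xi_perp v)).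
    by rewrite dotC.
  by left; rewrite /v' -scaleNr addrC brDr br_alt scaler0 add0r.
have {}noxi v : dot xi (br xi v) = 0.
  by apply/eqP; apply: contra_notT noxi => xiv; exists v.
have noxi' v : dot xi (br v xi) = 0 by rewrite brC dotNr noxi oppr0.
pose u' := u - (dot xi u / b ^+ 2) *: xi.
have u'w : dot xi (br u' w) != 0.
  by rewrite /u' -scaleNr addrC brDl dotDr dotZr noxi mulr0 add0r.
have u'0 : u' != 0.
  by apply: contra u'w => /eqP ->; rewrite br0l dot0r.
have [nu [t [tn nuE nu2]]] := exists_unit u'0.
have xinu : dot xi nu = 0 by rewrite nuE dotZr xi_perp mulr0.
have nuw : dot xi (br nu w) != 0 by rewrite nuE brZl dotZr mulf_neq0.
pose w' := w - (dot xi w / b ^+ 2) *: xi - dot nu w *: nu.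
apply: (@randers_function_of_dbeta_plane nu nu2 xinu w').
- by rewrite /w' dotDr xi_perp dotNr dotZr xinu mulr0 subrr.
- rewrite /w' !dotDr !dotNr !dotZr nu2 (dotC nu xi) xinu; ring.
right; have -> : w' = (- (dot xi w / b ^+ 2)) *: xi + ((- dot nu w) *: nu + w).
  by rewrite /w' -!scaleNr addrAC addrC [w + _]addrC.
by rewrite !brDr br_alt scaler0 add0r dotDr dotZr noxi' mulr0 add0r.
Qed.

Lemma randers_function_of_hamel : (2 < n)%N ->
  ((forall u w, dot xi (br u w) = 0) ->
    exists2 nu, dot xi nu = 0 & dot nu (br xi nu) != 0) ->
  randers_function phi b.
Proof.
move=> n2 witness.
have [[u [w uw]]|closed] := pselect (exists u w, dot xi (br u w) != 0).
  exact: randers_function_of_dbeta_neq0 uw.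
have {}closed u w : dot xi (br u w) = 0.
  by apply/eqP; apply: contra_notT closed => uw; exists u, w.
have [nu xinu nubr] := witness closed.
have nu0 : nu != 0 by apply: contra nubr => /eqP ->; rewrite br0r dot0r.
have [nu' [t [t0 nuE nu2]]] := exists_unit nu0.
apply: (@randers_function_of_dbeta_eq0 nu' nu2 _ closed); first by rewrite nuE dotZr xinu mulr0.
by rewrite nuE brZr dotZl dotZr !mulf_neq0.
Qed.

End Hamel.

(** * The square of an (alpha, beta)-metric in an orthonormal frame *)

Lemma is_derive_mxP {R : realType} {V : normedModType R} m n
    (M : V -> 'M[R]_(m, n)) x v dM :
  is_derive x v M dM <->
  forall i j, is_derive x v (fun z => M z i j) (dM i j).
Proof.
split=> [[dMx <-] i j|dMx].
  by rewrite derive_mx // mxE; apply: derivableP; move/derivable_mxP : dMx.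
have dM' : derivable M x v by apply/derivable_mxP => i j; have [] := dMx i j.
split=> //; rewrite derive_mx//; apply/matrixP => i j; rewrite mxE.
by have [_ ->] := dMx i j.
Qed.

Lemma is_derive_dot {R : realType} {V : normedModType R} n
    (U W : V -> 'rV[R]_n) x v dU dW :
  is_derive x v U dU -> is_derive x v W dW ->
  is_derive x v (fun z => dot (U z) (W z)) (dot dU (W x) + dot (U x) dW).
Proof.
move=> /is_derive_mxP dU' /is_derive_mxP dW'.
rewrite (_ : (fun z => _) =
    \sum_i ((fun z => U z 0 i) * (fun z => W z 0 i))); last first.
  by apply/funext => z; rewrite fct_sumE.
have dUW i := is_deriveM (dU' 0 i) (dW' 0 i).
apply: (is_derive_eq (is_derive_sum dUW)).
rewrite /dot -big_split; apply: eq_bigr => i _ /=.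
by rewrite [RHS]addrC; congr (_ + _); exact: mulrC.
Qed.

Section SquaredMetric.
Context {R : realType} {n : nat}.
Variables (phi phi1 phi2 : R -> R) (b b0 : R) (xi : 'rV[R]_n).
Hypothesis b_ge0 : 0 <= b.
Hypothesis b_lt : b < b0.
Hypothesis dphi : forall s : R, `|s| < b0 -> is_derive s 1 phi (phi1 s).
Hypothesis dphi1 : forall s : R, `|s| < b0 -> is_derive s 1 phi1 (phi2 s).
Hypothesis xi2 : dot xi xi = b ^+ 2.
Implicit Types (u v w : 'rV[R]_n).

Definition len u : R := Num.sqrt (dot u u).
Definition slope u : R := dot xi u / len u.
Definition finsler_sqr u : R := (len u * phi (slope u)) ^+ 2.

Definition dlen u v : R := dot u v / len u.
Definition dslope u v : R := (dot xi v - slope u * dlen u v) / len u.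

(** The gradient of F^2 is grad_u u + |u| grad_xi xi, with coefficients
    evaluated at s = <xi,u>/|u|. *)
Definition grad_u s : R := 2 * phi s * (phi s - s * phi1 s).
Definition grad_xi s : R := 2 * phi s * phi1 s.
Definition dgrad_xi s : R := 2 * (phi1 s ^+ 2 + phi s * phi2 s).
(** The derivative of grad_u: from grad_u = 2 phi^2 - s grad_xi and
    (2 phi^2)' = 2 grad_xi. *)
Definition dgrad_u s : R := grad_xi s - s * dgrad_xi s.

Definition grad u w : R :=
  grad_u (slope u) * dot u w + len u * grad_xi (slope u) * dot xi w.

Definition hess u v w : R :=
  grad_u (slope u) * dot v w + dgrad_u (slope u) * dslope u v * dot u w
  + (dlen u v * grad_xi (slope u) + len u * dgrad_xi (slope u) * dslope u v) * dot xi w.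

Lemma len_gt0 u : u != 0 -> 0 < len u.
Proof. by move=> u0; rewrite sqrtr_gt0 dot_gt0. Qed.

Lemma len2 u : len u ^+ 2 = dot u u.
Proof. by rewrite sqr_sqrtr// dot_ge0. Qed.

Lemma slope_len u : u != 0 -> slope u * len u = dot xi u.
Proof. by move=> /len_gt0 l0; rewrite /slope divfK// gt_eqF. Qed.

Lemma dlen_self u : u != 0 -> dlen u u = len u.
Proof. by move=> /len_gt0 l0; rewrite /dlen -len2 expr2 mulfK// gt_eqF. Qed.

Lemma dslope_self u : u != 0 -> dslope u u = 0.
Proof. by move=> u0; rewrite /dslope dlen_self// slope_len// subrr mul0r. Qed.

Lemma dot_len_le u : `|dot xi u| <= b * len u.
Proof.
have bl : 0 <= b * len u by rewrite mulr_ge0// sqrtr_ge0.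
rewrite -ler_sqr ?nnegrE// real_normK ?num_real// exprMn len2 -xi2.
exact: dot_CS.
Qed.

Lemma slope_le u : `|slope u| <= b.
Proof.
have [->|u0] := eqVneq u 0.
  by rewrite /slope dot0r mul0r normr0.
rewrite normrM normfV (gtr0_norm (len_gt0 u0)) ler_pdivrMr ?len_gt0//.
exact: dot_len_le.
Qed.

Let slope_lt u : `|slope u| < b0. Proof. exact: le_lt_trans (slope_le u) b_lt. Qed.

(* Everything is differentiated along a map U with values in frame components:
   U is linear in the fibre coordinates y and depends on the point x through
   the coframe. *)
Section Along.
Context {V : normedModType R} (U : V -> 'rV[R]_n) (x v : V) (dU : 'rV[R]_n).
Hypothesis dUx : is_derive x v U dU.
Hypothesis Ux : U x != 0.

Lemma is_derive_len : is_derive x v (len \o U) (dlen (U x) dU).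
Proof.
have d2 := is_derive_dot dUx dUx.
have ds := is_derive1_sqrt (dot_gt0 Ux).
rewrite -[len \o U]/(Num.sqrt \o (fun z => dot (U z) (U z))).
have dsd := @is_derive_outer _ _ _ (fun z => dot (U z) (U z)) x v _ _ ds d2.
apply: is_derive_eq.
rewrite /dlen -/(len (U x)) (dotC dU); field; rewrite gt_eqF ?len_gt0//.
Qed.

Lemma is_derive_slope : is_derive x v (slope \o U) (dslope (U x) dU).
Proof.
have l0 : (len \o U) x != 0 by rewrite gt_eqF ?len_gt0.
have dl := is_derive_len.
have dx := is_derive_dot (is_derive_cst xi x v) dUx.
have dV : is_derive x v (fun y => ((len \o U) y)^-1)
    (- ((len \o U) x) ^- 2 * dlen (U x) dU).
  by have [dl1 dl2] := dl; split; [exact: derivableV | rewrite deriveV// dl2].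
rewrite -[slope \o U]/((fun z => dot (cst xi z) (U z)) *
  (fun z => ((len \o U) z)^-1)).
apply: (is_derive_eq (is_deriveM dx dV)).
rewrite /GRing.scale /= /dslope /slope dot0l /=.
by rewrite /cst; field.
Qed.

Lemma is_derive_finsler_sqr : is_derive x v (finsler_sqr \o U) (grad (U x) dU).
Proof.
have dl := is_derive_len; have dr := is_derive_slope.
have dp := @is_derive_outer _ _ phi (slope \o U) x v _ _
  (dphi (slope_lt (U x))) dr.
have -> : finsler_sqr \o U = ((len \o U) * (phi \o (slope \o U))) ^+ 2.
  by apply/funext => z; rewrite !fctE.
apply: is_derive_eq.
rewrite /grad /grad_u /grad_xi /dslope /dlen /GRing.scale /=.
rewrite !fctE /=.
have l0 : len (U x) != 0 by rewrite gt_eqF ?len_gt0.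
by field.
Qed.

Lemma is_derive_grad (W : V -> 'rV[R]_n) dW : is_derive x v W dW ->
  is_derive x v (fun z => grad (U z) (W z))
    (hess (U x) dU (W x) + grad (U x) dW).
Proof.
move=> dWx.
have dl := is_derive_len; have dr := is_derive_slope.
have dp := @is_derive_outer _ _ phi (slope \o U) x v _ _
  (dphi (slope_lt (U x))) dr.
have dp1 := @is_derive_outer _ _ phi1 (slope \o U) x v _ _
  (dphi1 (slope_lt (U x))) dr.
have dUW := is_derive_dot dUx dWx.
have dxW := is_derive_dot (is_derive_cst xi x v) dWx.
pose f := phi \o (slope \o U); pose f1 := phi1 \o (slope \o U).
have -> : (fun z => grad (U z) (W z)) =
   (cst 2 * f * (f - (slope \o U) * f1)) * (fun z => dot (U z) (W z))
   + (len \o U) * (cst 2 * f * f1) * (fun z => dot (cst xi z) (W z)).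
  by apply/funext => z; rewrite !fctE.
have d2 := is_derive_cst (2 : R) x v.
apply: (is_derive_eq (is_deriveD
  (is_deriveM (is_deriveM (is_deriveM d2 dp) (is_deriveB dp (is_deriveM dr dp1)))
    dUW)
  (is_deriveM (is_deriveM dl (is_deriveM (is_deriveM d2 dp) dp1)) dxW))).
rewrite /hess /grad /dgrad_u /dgrad_xi /grad_u /grad_xi /f /f1 /GRing.scale /= !fctE /=.
by rewrite dot0l /cst; ring.
Qed.

End Along.
End SquaredMetric.

Lemma is_derive_mulmx {R : realType} {V : normedModType R} m n p
    (U : V -> 'M[R]_(m, n)) (W : V -> 'M[R]_(n, p)) x v dU dW :
  is_derive x v U dU -> is_derive x v W dW ->
  is_derive x v (fun z => U z *m W z) (dU *m W x + U x *m dW).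
Proof.
move=> /is_derive_mxP dU' /is_derive_mxP dW'; apply/is_derive_mxP => i j.
rewrite (_ : (fun z => _) =
    \sum_k ((fun z => U z i k) * (fun z => W z k j))); last first.
  by apply/funext => z; rewrite mxE fct_sumE.
have dUW k := is_deriveM (dU' i k) (dW' k j).
apply: (is_derive_eq (is_derive_sum dUW)).
rewrite !mxE -big_split; apply: eq_bigr => k _ /=.
by rewrite [RHS]addrC; congr (_ + _); exact: mulrC.
Qed.

(** * The Euler-Lagrange expression and Hamel's equation *)

Lemma posdef_unitmx {R : realType} n (g : 'M[R]_n) :
  (forall w : 'rV[R]_n, w != 0 -> 0 < \sum_i \sum_j g i j * w 0 i * w 0 j) ->
  g \in unitmx.
Proof.
move=> pos; rewrite unitmxE unitfE; apply/negP => /det0P[v v0 vg].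
have := pos v v0; rewrite exchange_big /= big1 ?ltxx// => j _.
have /rowP/(_ j) := vg; rewrite !mxE => vgj.
transitivity ((\sum_i v 0 i * g i j) * v 0 j); last by rewrite vgj mul0r.
by rewrite mulr_suml; apply: eq_bigr => i _; rewrite [g i j * _]mulrC.
Qed.

Lemma linear_form_sum {R : realType} {V : lmodType R} (f : V -> R) n
    (t : 'I_n -> R) (v : 'I_n -> V) :
  (forall k x y, f (k *: x + y) = k * f x + f y) ->
  f (\sum_i t i *: v i) = \sum_i t i * f (v i).
Proof.
move=> flin; have f0 : f 0 = 0.
  have := flin 1 0 0; rewrite scaler0 addr0 mul1r => /eqP.
  by rewrite eq_sym -subr_eq0 addrK => /eqP.
apply: (big_rec2 (fun x y => f x = y)) => // i x y _ fxy.
by rewrite flin fxy.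
Qed.

Lemma near_neq0 {R : realType} {V : normedModType R} (y : V) :
  y != 0 -> \forall z \near y, z != 0.
Proof. by move=> y0; apply: (@cvgr_neq0 _ _ _ _ _ id y); [exact: cvg_id|]. Qed.

Section EulerLagrange.
Context {R : realType} {n : nat}.
Variables (phi phi1 phi2 : R -> R) (b b0 : R) (xi : 'rV[R]_n).
Hypothesis b_ge0 : 0 <= b.
Hypothesis b_lt : b < b0.
Hypothesis dphi : forall s : R, `|s| < b0 -> is_derive s 1 phi (phi1 s).
Hypothesis dphi1 : forall s : R, `|s| < b0 -> is_derive s 1 phi1 (phi2 s).
Hypothesis xi2 : dot xi xi = b ^+ 2.
Implicit Types (u v w y z : 'rV[R]_n).

Local Notation dH := (grad phi phi1 xi).
Local Notation ddH := (hess phi phi1 phi2 xi).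

Lemma grad_lin u k v w : dH u (k *: v + w) = k * dH u v + dH u w.
Proof. by rewrite /grad !(dotDr, dotZr); ring. Qed.

Lemma hess_linr u v k w w' :
  ddH u v (k *: w + w') = k * ddH u v w + ddH u v w'.
Proof. by rewrite /hess !(dotDr, dotZr); ring. Qed.

Lemma hess_linl u k v v' w :
  ddH u (k *: v + v') w = k * ddH u v w + ddH u v' w.
Proof. by rewrite /hess /dslope /dlen !(dotDr, dotZr, dotDl, dotZl); ring. Qed.

(** Euler's relation: the differential of F^2 is homogeneous of degree one. *)
Lemma hess_euler u w : u != 0 -> ddH u u w = dH u w.
Proof.
move=> u0; rewrite /hess /grad dslope_self// dlen_self//; ring.
Qed.

Lemma hess_sym u v w : u != 0 -> ddH u v w = ddH u w v.
Proof.
move=> /len_gt0 l0; rewrite /hess /dslope /dlen /dgrad_u (dotC w v).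
by field; rewrite gt_eqF.
Qed.

(** The rows of E x are the frame fields in the coordinates of the chart and N x
    is the inverse matrix, so y *m N x are the frame components of the
    tangent vector with coordinates y. *)
Section Chart.
Context {M : topologicalType} (A : smooth_structure R n M).
Variables (F : M -> tvec R M -> R) (c : chart R n M) (x0 : 'rV[R]_n).
Variables (E N : 'rV[R]_n -> 'M[R]_n) (dE : 'rV[R]_n -> 'M[R]_n).
Hypothesis cx0 : cimg c x0.
Hypothesis F_frame : forall x y, cimg c x ->
  local_expr A F c x y = len (y *m N x) * phi (slope xi (y *m N x)).
Hypothesis EN : forall x, cimg c x -> E x *m N x = 1%:M.
Hypothesis dEx0 : forall v, is_derive x0 v E (dE v).
Hypothesis dE_lin : forall v, dE v = \sum_r v 0 r *: dE (delta_mx 0 r).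
Hypothesis dNx0 : forall v, derivable N x0 v.

Let F2 x y := local_expr A F c x y ^+ 2.
Let N0 := N x0.
Let E0 := E x0.
Let dN v := - (N0 *m dE v *m N0).

Let NE0 : N0 *m E0 = 1%:M. Proof. by apply: mulmx1C; exact: EN. Qed.

Let near_cimg : \forall x \near x0, cimg c x.
Proof. by apply: open_nbhs_nbhs; split=> //; exact: cimg_open. Qed.

(** Differentiating E N = 1. *)
Lemma is_derive_coframe v : is_derive x0 v N (dN v).
Proof.
have dNv := derivableP (@dNx0 v).
have dEN := is_derive_mulmx (@dEx0 v) dNv.
have d0 : is_derive x0 v (fun z => E z *m N z) 0.
  apply: near_eq_is_derive (is_derive_cst 1%:M x0 v).
  by near=> z; rewrite EN //; near: z.
have [_ e1] := dEN; have [_ e2] := d0.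
suff -> : dN v = 'D_v N x0 by [].
have /eqP : dE v *m N x0 + E x0 *m 'D_v N x0 = 0 by rewrite -e1 e2.
rewrite addrC addr_eq0 => /eqP/(congr1 (mulmx N0)).
by rewrite mulmxA NE0 mul1mx => ->; rewrite /dN mulmxN mulmxA.
Unshelve. all: by end_near. Qed.

Let UN0 y : y != 0 -> y *m N0 != 0.
Proof.
apply: contra => /eqP/(congr1 (fun z : 'rV[R]_n => z *m E0)).
by rewrite -mulmxA NE0 mulmx1 mul0mx => ->.
Qed.

Let dU (y v : 'rV[R]_n) (K : 'M[R]_n) : is_derive y v (fun z : 'rV[R]_n => z *m K) (v *m K).
Proof.
apply: (is_derive_eq (is_derive_mulmx (is_derive_id y v) (is_derive_cst K y v))).
by rewrite mulmx0 addr0.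
Qed.

Lemma partial_yE j y : y != 0 ->
  partial_y j F2 x0 y = dH (y *m N0) (delta_mx 0 j *m N0).
Proof.
move=> y0; rewrite /partial_y.
have [_ <-] := is_derive_finsler_sqr b_ge0 b_lt dphi xi2 (dU y (delta_mx 0 j) N0) (UN0 y0).
rewrite (_ : F2 x0 = finsler_sqr phi xi \o (fun z : 'rV[R]_n => z *m N0))//.
by apply/funext => z; rewrite /F2 F_frame.
Qed.

Lemma partial_xE r y : y != 0 ->
  partial_x r F2 x0 y = dH (y *m N0) (y *m dN (delta_mx 0 r)).
Proof.
move=> y0; rewrite /partial_x.
have dUr : is_derive x0 (delta_mx 0 r) (fun x => y *m N x) (y *m dN (delta_mx 0 r)).
  apply: (is_derive_eq (is_derive_mulmx (is_derive_cst y x0 _) (is_derive_coframe _))).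
  by rewrite mul0mx add0r.
have [_ <-] := is_derive_finsler_sqr b_ge0 b_lt dphi xi2 dUr (UN0 y0).
apply: near_eq_derive; near=> x; rewrite /F2 F_frame//; near: x; exact: near_cimg.
Unshelve. all: by end_near. Qed.

Lemma partial_yyE i j y : y != 0 ->
  partial_y j (partial_y i F2) x0 y =
  ddH (y *m N0) (delta_mx 0 j *m N0) (delta_mx 0 i *m N0).
Proof.
move=> y0; rewrite {1}/partial_y.
have dg := is_derive_grad b_ge0 b_lt dphi dphi1 xi2 (dU y (delta_mx 0 j) N0)
  (UN0 y0) (is_derive_cst (delta_mx 0 i *m N0) y (delta_mx 0 j)).
have grad0 u : dH u 0 = 0.
  by have := grad_lin u (-1) 0 0; rewrite scaler0 addr0 mulN1r addNr.
have [_ dgE] := dg; rewrite grad0 addr0 in dgE; rewrite -dgE.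
apply: near_eq_derive; near=> z; rewrite partial_yE//; near: z; exact: (near_neq0 y0).
Unshelve. all: by end_near. Qed.

Lemma partial_yxE r j y : y != 0 ->
  partial_y j (partial_x r F2) x0 y =
  ddH (y *m N0) (delta_mx 0 j *m N0) (y *m dN (delta_mx 0 r))
  + dH (y *m N0) (delta_mx 0 j *m dN (delta_mx 0 r)).
Proof.
move=> y0; rewrite {1}/partial_y.
have [_ <-] := is_derive_grad b_ge0 b_lt dphi dphi1 xi2 (dU y (delta_mx 0 j) N0)
  (UN0 y0) (dU y (delta_mx 0 j) (dN (delta_mx 0 r))).
apply: near_eq_derive; near=> z; rewrite partial_xE//; near: z; exact: (near_neq0 y0).
Unshelve. all: by end_near. Qed.

Let dN_lin v : dN v = \sum_r v 0 r *: dN (delta_mx 0 r).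
Proof.
rewrite /dN dE_lin mulmx_sumr mulmx_suml -sumrN; apply: eq_bigr => r _.
by rewrite -scalemxAr -scalemxAl scalerN.
Qed.

Let row_sum (v : 'rV[R]_n) m (K : 'M[R]_(n, m)) :
  \sum_j v 0 j *: (delta_mx 0 j *m K) = v *m K.
Proof.
rewrite {2}(row_sum_delta v) mulmx_suml.
by apply: eq_bigr => j _; rewrite scalemxAl.
Qed.

(** The last two terms combine to the differential of F^2 along the bracket of
    the frame fields with components y *m N0 and z *m N0. *)
Lemma euler_lagrangeE y z : y != 0 ->
  \sum_j z 0 j * (\sum_r partial_y j (partial_x r F2) x0 y * y 0 r
                  - partial_x j F2 x0 y) =
  ddH (y *m N0) (z *m N0) (y *m dN y) + dH (y *m N0) (z *m dN y)
  - dH (y *m N0) (y *m dN z).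
Proof.
move=> y0; rewrite -/(dN y) -/(dN z).
pose e j : 'rV[R]_n := delta_mx 0 j.
transitivity (\sum_j z 0 j * (ddH (y *m N0) (e j *m N0) (y *m dN y)
    + dH (y *m N0) (e j *m dN y) - dH (y *m N0) (y *m dN (e j)))).
  apply: eq_bigr => j _; congr (_ * (_ - _)); last exact: partial_xE.
  have -> : y *m dN y = \sum_r y 0 r *: (y *m dN (e r)).
    by rewrite dN_lin mulmx_sumr; apply: eq_bigr => r _; rewrite scalemxAr.
  have -> : e j *m dN y = \sum_r y 0 r *: (e j *m dN (e r)).
    by rewrite dN_lin mulmx_sumr; apply: eq_bigr => r _; rewrite scalemxAr.
  rewrite (linear_form_sum _ _ (hess_linr _ _)) (linear_form_sum _ _ (grad_lin _)).
  rewrite -big_split; apply: eq_bigr => r _ /=.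
  by rewrite partial_yxE// mulrC mulrDr.
have -> : z *m N0 = \sum_j z 0 j *: (e j *m N0) by rewrite row_sum.
have -> : z *m dN y = \sum_j z 0 j *: (e j *m dN y) by rewrite row_sum.
have -> : y *m dN z = \sum_j z 0 j *: (y *m dN (e j)).
  by rewrite dN_lin mulmx_sumr; apply: eq_bigr => r _; rewrite scalemxAr.
rewrite !(linear_form_sum _ _ (grad_lin _)).
rewrite (@linear_form_sum _ _ (fun v => ddH (y *m N0) v (y *m dN y)))//; last first.
  by move=> k u v; exact: hess_linl.
rewrite -big_split -sumrB; apply: eq_bigr => j _ /=.
by rewrite mulrBr mulrDr.
Qed.

(** The spray is the Euler-Lagrange vector raised with the inverse of the
    fundamental tensor, which is half of the Hessian of F^2. *)
Lemma spray_euler_lagrange y z : y != 0 ->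
  (forall w, w != 0 ->
    0 < \sum_i \sum_j fundamental_tensor A F c x0 y i j * w 0 i * w 0 j) ->
  \sum_j z 0 j * (\sum_r partial_y j (partial_x r F2) x0 y * y 0 r
                  - partial_x j F2 x0 y) =
  2 * ddH (y *m N0) ((\row_i spray A F c x0 y i) *m N0) (z *m N0).
Proof.
move=> y0 /posdef_unitmx; set g := fundamental_tensor A F c x0 y => gU.
pose EL := \col_j (\sum_r partial_y j (partial_x r F2) x0 y * y 0 r
                  - partial_x j F2 x0 y).
pose S := \col_i spray A F c x0 y i.
have SE : 4 *: S = invmx g *m EL.
  apply/colP => i; rewrite !mxE /spray mulrA divff// mul1r.
  by apply: eq_bigr => j _; rewrite mxE.
have ELE : EL = 4 *: (g *m S) by rewrite scalemxAr SE mulKVmx.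
pose e j : 'rV[R]_n := delta_mx 0 j.
transitivity (\sum_j z 0 j * (2 * ddH (y *m N0)
    ((\row_i spray A F c x0 y i) *m N0) (e j *m N0))).
  apply: eq_bigr => j _; congr (_ * _).
  have /colP/(_ j) := ELE; rewrite !mxE => ->.
  rewrite -(row_sum (\row_i _)).
  rewrite (@linear_form_sum _ _ (fun v => ddH (y *m N0) v (e j *m N0)))//; last first.
    by move=> k u v; exact: hess_linl.
  rewrite !mulr_sumr; apply: eq_bigr => i _; rewrite !mxE.
  by rewrite partial_yyE//; field.
rewrite -[in RHS](row_sum z) (linear_form_sum _ _ (hess_linr _ _)) mulr_sumr.
by apply: eq_bigr => j _; rewrite mulrCA.
Qed.

(** This is the bracket of the combinations of frame fields with constant
    coefficients u and w, at x0: the coordinate vector (D Y)(X) - (D X)(Y)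
    converted to frame components. *)
Definition frame_bracket u w : 'rV[R]_n :=
  (w *m dE (u *m E x0) - u *m dE (w *m E x0)) *m N x0.

(** The quadratic part Gamma(y, y) of the spray, corrected by the derivative of
    the frame so that it can be compared with the bracket. *)
Definition frame_spray (Gam : 'I_n -> 'I_n -> 'I_n -> R) u : 'rV[R]_n :=
  let y := u *m E x0 in
  (\row_i (\sum_j \sum_r Gam i j r * y 0 j * y 0 r) + u *m dE y) *m N x0.

Let dE_linear k u v : dE (k *: u + v) = k *: dE u + dE v.
Proof.
rewrite !(dE_lin (_ + _)) (dE_lin u) (dE_lin v) scaler_sumr -big_split.
by apply: eq_bigr => r _; rewrite !mxE scalerDl scalerA.
Qed.

Lemma frame_bracketDl k u v w :
  frame_bracket (k *: u + v) w = k *: frame_bracket u w + frame_bracket v w.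
Proof.
rewrite /frame_bracket scalemxAl -mulmxDl; congr (_ *m _).
rewrite !mulmxDl -!scalemxAl dE_linear mulmxDr -scalemxAr scalerBr.
by rewrite opprD addrACA.
Qed.

Lemma frame_bracket_alt u : frame_bracket u u = 0.
Proof. by rewrite /frame_bracket subrr mul0mx. Qed.

Lemma frame_bracketC u w : frame_bracket u w = - frame_bracket w u.
Proof. by rewrite /frame_bracket -[RHS]mulNmx opprB. Qed.

Lemma frame_bracketDr k u v w :
  frame_bracket w (k *: u + v) = k *: frame_bracket w u + frame_bracket w v.
Proof.
by rewrite frame_bracketC frame_bracketDl opprD -scalerN -!frame_bracketC.
Qed.

Lemma quadratic_frame_spray Gam : quadratic_map (frame_spray Gam).
Proof.
move=> u v; pose y := u *m E x0; pose z := v *m E x0.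
pose B (a b : 'rV[R]_n) := \row_i (\sum_j \sum_r Gam i j r * a 0 j * b 0 r).
exists ((B y y + u *m dE y) *m N x0),
  ((B y z + B z y + (u *m dE z + v *m dE y)) *m N x0),
  ((B z z + v *m dE z) *m N x0) => s r.
have yE : (s *: u + r *: v) *m E x0 = s *: y + r *: z.
  by rewrite mulmxDl -!scalemxAl.
rewrite /frame_spray !scalemxAl -!mulmxDl.
congr (_ *m _); apply/rowP => i.
have dEr k a : dE (k *: a) = k *: dE a.
  have dE0 : dE 0 = 0 by rewrite dE_lin big1// => j _; rewrite mxE scale0r.
  by have := dE_linear k a 0; rewrite dE0 !addr0.
rewrite yE dE_linear dEr !mulmxDr !mulmxDl -!scalemxAr -!scalemxAl.
move: (u *m dE y) (u *m dE z) (v *m dE y) (v *m dE z) => d1 d2 d3 d4.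
rewrite !mxE.
have -> : \sum_j \sum_r0 Gam i j r0 * (s *: y + r *: z) 0 j * (s *: y + r *: z) 0 r0
  = s ^+ 2 * (\sum_j \sum_r0 Gam i j r0 * y 0 j * y 0 r0)
   + s * r * (\sum_j \sum_r0 Gam i j r0 * y 0 j * z 0 r0)
   + s * r * (\sum_j \sum_r0 Gam i j r0 * z 0 j * y 0 r0)
   + r ^+ 2 * (\sum_j \sum_r0 Gam i j r0 * z 0 j * z 0 r0).
  rewrite !mulr_sumr -!big_split; apply: eq_bigr => j _ /=.
  rewrite !mulr_sumr -!big_split; apply: eq_bigr => k _ /=.
  by rewrite !mxE; ring.
by ring.
Qed.

(** The Euler-Lagrange expression is computed twice: from the dependence of F
    on the frame, and from the Douglas form of the spray. Equating both gives
    Hamel's equation for F^2 with an additional multiple of its differential,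
    coming from P. Taking w = u determines P, because the bracket is
    alternating, and substituting it turns the equation for F^2 into the one
    for F. *)
Lemma hamel_of_douglas (Gam : 'I_n -> 'I_n -> 'I_n -> R) (P : 'rV[R]_n -> R) :
  (forall s, `|s| <= b -> 0 < phi s) ->
  (forall y w, y != 0 -> w != 0 ->
    0 < \sum_i \sum_j fundamental_tensor A F c x0 y i j * w 0 i * w 0 j) ->
  (forall y, y != 0 -> forall i, spray A F c x0 y i =
    2^-1 * (\sum_j \sum_r Gam i j r * y 0 j * y 0 r) + P y * y 0 i) ->
  forall u, dot u u = 1 -> forall w, let s := dot xi u in
  let gam := frame_spray Gam u in
  (phi s - s * phi1 s) * (dot gam w - dot u gam * dot u w)
  + phi2 s * (dot xi gam - s * dot u gam) * (dot xi w - s * dot u w)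
  = - ((phi s - s * phi1 s) * dot u (frame_bracket u w)
       + phi1 s * dot xi (frame_bracket u w)).
Proof.
move=> phi_gt0 pos doug u u1 w s gam.
have u0 : u != 0 by rewrite -dot_eq0 u1 oner_eq0.
pose y := u *m E0; have yN : y *m N0 = u by rewrite -mulmxA EN// mulmx1.
have y0 : y != 0.
  by apply: contra u0 => /eqP y0; rewrite -yN y0 mul0mx.
have key v : ddH u gam v + 2 * P y * dH u v = - dH u (frame_bracket u v).
  pose z := v *m E0; have zN : z *m N0 = v by rewrite -mulmxA EN// mulmx1.
  have := euler_lagrangeE z y0; rewrite (spray_euler_lagrange z y0 (fun w => pos y w y0)).
  rewrite yN zN.
  have -> : (\row_i spray A F c x0 y i) *m N0 =
      2^-1 *: (gam - u *m dE y *m N0) + P y *: u.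
    rewrite /gam /frame_spray -/E0 -/y -mulmxBl addrK scalemxAl -[in X in _ + X]yN.
    rewrite scalemxAl -mulmxDl; congr (_ *m _); apply/rowP => i.
    by rewrite [LHS]mxE doug// [RHS]mxE; congr (_ + _); rewrite !mxE.
  have -> : z *m dN y = - (v *m dE y *m N0).
    by rewrite /dN mulmxN -zN !mulmxA.
  have -> : y *m dN z = - (u *m dE z *m N0).
    by rewrite /dN mulmxN -yN !mulmxA yN.
  have -> : y *m dN y = - (u *m dE y *m N0).
    by rewrite /dN mulmxN !mulmxA yN.
  have dHN a : dH u (- a) = - dH u a.
    by rewrite /grad !dotNr; ring.
  have ddHNr a a' : ddH u a (- a') = - ddH u a a'.
    by rewrite /hess !dotNr; ring.
  have ddHNl a a' : ddH u (- a) a' = - ddH u a a'.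
    by rewrite hess_sym// ddHNr hess_sym.
  have ddHZl k a a' : ddH u (k *: a) a' = k * ddH u a a'.
    by rewrite hess_sym// [in RHS]hess_sym// /hess !dotZr; ring.
  have brE : frame_bracket u v = v *m dE y *m N0 - u *m dE z *m N0.
    by rewrite /frame_bracket mulmxBl.
  have ddHDl d d' a' : ddH u (d + d') a' = ddH u d a' + ddH u d' a'.
    by have := hess_linl u 1 d d' a'; rewrite scale1r mul1r.
  rewrite brE; move: (v *m dE y *m N0) (u *m dE z *m N0) (u *m dE y *m N0).
  move=> a1 a2 T; rewrite ddHDl !ddHZl hess_euler// ddHDl !ddHNl ddHNr !dHN.
  rewrite (hess_sym v)// => e.
  have -> : dH u (a1 - a2) = dH u a1 - dH u a2 by rewrite /grad !(dotDr, dotNr); ring.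
  by apply: (eq_by_sub e); field.
have l1 : len u = 1 by rewrite /len u1 sqrtr1.
have sE : slope xi u = s by rewrite /slope l1 divr1.
have phin : phi s != 0 by rewrite gt_eqF// phi_gt0// -sE slope_le.
have := key w; have := key u.
rewrite /grad /hess /dslope /dlen sE l1 u1 !frame_bracket_alt.
rewrite /dgrad_u /grad_u /grad_xi /dgrad_xi !divr1 !mul1r -/s.
rewrite !dot0r (dotC gam u) => eu ew.
apply: (eq_by_sub (congr1 (fun x => x / (2 * phi s)) ew)).
apply: (eq_by_sub (congr1 (fun x => - x * ((phi s - s * phi1 s) * dot u w
  + phi1 s * dot xi w) / (2 * phi s ^+ 2)) eu)).
by field.
Qed.

End Chart.
End EulerLagrange.

(** * Tangent vectors and vector fields in a chart *)

Section Charts.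
Context {R : realType} {n : nat} {M : topologicalType}.
Variable A : smooth_structure R n M.
Implicit Types (c : chart R n M) (p : M) (x y z : 'rV[R]_n) (f : M -> R).

Definition chart_coord c (i : 'I_n) : M -> R := fun p => cmap c p 0 i.

Lemma cdom_cinv c x : cimg c x -> cdom c (cinv c x).
Proof. by move=> [p cp <-]; rewrite cmapK. Qed.

Lemma cinvK c x : cimg c x -> cmap c (cinv c x) = x.
Proof. by move=> [p cp <-]; rewrite cmapK. Qed.

Lemma cimg_cmap c p : cdom c p -> cimg c (cmap c p).
Proof. by move=> cp; exists p. Qed.

Lemma open_cmap_image c (U : set M) :
  open U -> open (cmap c @` (cdom c `&` U)).
Proof.
move=> oU; rewrite openE => _ [p [cp Up] <-].
have cx := cimg_cmap cp.
have nU : \forall z \near cmap c p, U (cinv c z).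
  by apply: (cinv_continuous cx); rewrite cmapK//; exact: open_nbhs_nbhs.
have nC : \forall z \near cmap c p, cimg c z.
  by apply: open_nbhs_nbhs; split=> //; exact: cimg_open.
rewrite /interior /=; near=> z.
have cz : cimg c z by near: z.
exists (cinv c z); last exact: cinvK.
by split; [exact: cdom_cinv | near: z].
Unshelve. all: by end_near. Qed.

Lemma smooth_coord c i : atlas A c -> smooth_on A (cdom c) (chart_coord c i).
Proof.
move=> Ac c' Ac'; have := atlas_smooth Ac' Ac; rewrite /smooth_transition => Ct.
apply: (@Cinfty_coord _ _ _ _ (cmap c \o cinv c')) => //.
by apply: open_cmap_image; exact: cdom_open.
Qed.

Lemma smooth_on_near (U : set M) p f :
  open U -> U p -> smooth_on A U f -> smooth_near A p f.
Proof. by move=> oU Up sf; exists U. Qed.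

Lemma smooth_near_differentiable c p f : atlas A c -> cdom c p ->
  smooth_near A p f -> differentiable (f \o cinv c : _ -> R^o) (cmap c p).
Proof.
move=> Ac cp [U [oU Up sf]].
apply: (@Cinfty_differentiable _ _ (cmap c @` (cdom c `&` U))).
- exact: open_cmap_image.
- exact: sf.
- by exists p.
Qed.

Lemma coord_vec_linear c x t y z : atlas A c -> cimg c x ->
  coord_vec A c x (t *: y + z) = t *: coord_vec A c x y + coord_vec A c x z.
Proof.
move=> Ac cx; apply/funext => f.
rewrite -[RHS]/(t *: coord_vec A c x y f + coord_vec A c x z f) /coord_vec.
case: asboolP => [sf|_]; last by rewrite scaler0 addr0.
have := smooth_near_differentiable Ac (cdom_cinv cx) sf; rewrite cinvK// => df.
exact: derive_dirD.
Qed.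

Lemma smooth_near_coord c i x : atlas A c -> cimg c x ->
  smooth_near A (cinv c x) (chart_coord c i).
Proof.
move=> Ac cx; apply: (@smooth_on_near (cdom c)); first exact: cdom_open.
  exact: cdom_cinv.
exact: smooth_coord.
Qed.

(** A tangent vector is recovered from its values on the coordinate functions;
    this is what makes coordinates comparable. *)
Lemma coord_vec_coord c x y i : atlas A c -> cimg c x ->
  coord_vec A c x y (chart_coord c i) = y 0 i.
Proof.
move=> Ac cx; rewrite /coord_vec asboolT; last exact: smooth_near_coord.
have dy : is_derive x y (fun z : 'rV[R]_n => z 0 i) (y 0 i).
  by move: (is_derive_id x y) => /is_derive_mxP.
have [_ <-] := dy; apply: near_eq_derive; near=> z.
rewrite /= /chart_coord cinvK//; near: z; apply: open_nbhs_nbhs; split=> //.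
exact: cimg_open.
Unshelve. all: by end_near. Qed.

Lemma tangent_coord_vec c x y : atlas A c -> cimg c x ->
  tangent A (cinv c x) (coord_vec A c x y).
Proof.
move=> Ac cx; exists c, y; split=> //; first exact: cdom_cinv.
by rewrite cinvK.
Qed.

Definition components c (v : tvec R M) : 'rV[R]_n := \row_i v (chart_coord c i).

(** Tangent vectors are given in a chart of their own; the chain rule for the
    transition map brings them to the chart c. *)
Lemma coord_vec_components c x v : atlas A c -> cimg c x ->
  tangent A (cinv c x) v -> v = coord_vec A c x (components c v).
Proof.
move=> Ac cx [c' [y' [Ac' cp' ->]]].
set p := cinv c x in cp' *; pose x' := cmap c' p.
have cp : cdom c p := cdom_cinv cx.
have px : cmap c p = x := cinvK cx.
pose tau := cmap c \o cinv c'.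
pose y := 'D_y' tau x'.
have dtau : is_derive x' y' tau y.
  have Tx' : (cmap c' @` (cdom c' `&` cdom c)) x' by exists p.
  by have [_ /(_ y')/derivableP] := atlas_smooth Ac' Ac [::] Tx'.
have taux : tau x' = x by rewrite /tau /= /x' cmapK.
have vE : coord_vec A c' x' y' = coord_vec A c x y.
  apply/funext => f; rewrite /coord_vec /x' cmapK// -/p.
  case: asboolP => // sf.
  have df := smooth_near_differentiable Ac cp sf; rewrite px -taux in df.
  have [_ dcomp] := is_derive_chain df dtau.
  rewrite -taux -dcomp -/x'.
  apply: near_eq_derive; near=> z.
  have [q [cq' cq] <-] : (cmap c' @` (cdom c' `&` cdom c)) z.
    near: z; apply: open_nbhs_nbhs; split; last by exists p.
    by apply: open_cmap_image; exact: cdom_open.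
  by rewrite /tau /= !cmapK.
rewrite vE; congr (coord_vec A c x _); apply/rowP => i.
by rewrite mxE coord_vec_coord.
Unshelve. all: by end_near. Qed.

Lemma tangentZ p (t : R) v : tangent A p v -> tangent A p (t *: v).
Proof.
move=> [c [y [Ac cp ->]]]; exists c, (t *: y); split=> //.
have cx := cimg_cmap cp.
have c0 : coord_vec A c (cmap c p) 0 = 0.
  have := coord_vec_linear (-1) 0 0 Ac cx.
  by rewrite scaler0 addr0 scaleN1r addNr.
by have := coord_vec_linear t y 0 Ac cx; rewrite c0 !addr0.
Qed.

Lemma smooth_components c (X : vfield R M) i : atlas A c ->
  is_vector_field A X ->
  Cinfty (cimg c) (fun x => X (cinv c x) (chart_coord c i) : R).
Proof.
move=> Ac [_ sX].
have := sX (cdom c) (chart_coord c i) (@cdom_open _ _ _ c) (smooth_coord i Ac).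
by move=> /(_ c Ac); rewrite setIid.
Qed.

(** The classical formula X(Y^i) - Y(X^i). *)
Lemma lie_bracket_components c x (X Y : vfield R M) i :
  atlas A c -> cimg c x -> is_vector_field A X -> is_vector_field A Y ->
  lie_bracket A X Y (cinv c x) (chart_coord c i) =
  'D_(components c (X (cinv c x))) (fun z => Y (cinv c z) (chart_coord c i) : R) x
  - 'D_(components c (Y (cinv c x))) (fun z => X (cinv c z) (chart_coord c i) : R) x.
Proof.
move=> Ac cx vX vY; rewrite /lie_bracket asboolT; last exact: smooth_near_coord.
have half (Z T : vfield R M) : is_vector_field A Z -> is_vector_field A T ->
    Z (cinv c x) (fun q => T q (chart_coord c i)) =
    'D_(components c (Z (cinv c x))) (fun z => T (cinv c z) (chart_coord c i) : R) x.
  move=> [tZ _] [_ sT]; rewrite {1}(coord_vec_components Ac cx (tZ _)).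
  rewrite /coord_vec asboolT//.
  apply: (@smooth_on_near (cdom c)); first exact: cdom_open.
    exact: cdom_cinv.
  by apply: sT; [exact: cdom_open | exact: smooth_coord].
by rewrite !half.
Qed.

End Charts.

(** * Orthonormal frames *)

Section OrthonormalFrame.
Context {R : realType} {n : nat} {M : topologicalType}.
Variables (A : smooth_structure R n M) (a : M -> tvec R M -> tvec R M -> R).
Variables (c : chart R n M) (E : 'I_n -> vfield R M).
Hypothesis ra : riemannian A a.
Hypothesis Ac : atlas A c.
Hypothesis vE : forall i, is_vector_field A (E i).
Hypothesis orthoE : forall p i j, a p (E i p) (E j p) = (i == j)%:R.
Implicit Types (x y z : 'rV[R]_n) (p : M).

Definition frame x : 'M[R]_n :=
  \matrix_(i, j) E i (cinv c x) (chart_coord c j).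

Definition gram x : 'M[R]_n := \matrix_(i, j)
  a (cinv c x) (coord_vec A c x (delta_mx 0 i)) (coord_vec A c x (delta_mx 0 j)).

(** Orthonormality makes this product the inverse of the frame matrix; the
    formula shows at once that it is differentiable. *)
Definition coframe x : 'M[R]_n := gram x *m (frame x)^T.

Lemma row_frame i x : row i (frame x) = components c (E i (cinv c x)).
Proof. by apply/rowP => j; rewrite !mxE. Qed.

Lemma frame_vec i x : cimg c x ->
  E i (cinv c x) = coord_vec A c x (row i (frame x)).
Proof.
by move=> cx; rewrite row_frame -coord_vec_components//; exact: (vE i).1.
Qed.

Lemma metric_sum_l x y v : cimg c x -> tangent A (cinv c x) v ->
  a (cinv c x) (coord_vec A c x y) v =
  \sum_i y 0 i * a (cinv c x) (coord_vec A c x (delta_mx 0 i)) v.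
Proof.
move=> cx tv; have [_ aD _ _] := ra.
rewrite {1}(row_sum_delta y).
apply: (linear_form_sum (f := fun z => a (cinv c x) (coord_vec A c x z) v)).
move=> k u w; rewrite coord_vec_linear// aD//; exact: tangent_coord_vec.
Qed.

Lemma metric_gram x y z : cimg c x ->
  a (cinv c x) (coord_vec A c x y) (coord_vec A c x z) = dot (y *m gram x) z.
Proof.
move=> cx; have [aC _ _ _] := ra.
have tx w : tangent A (cinv c x) (coord_vec A c x w) by exact: tangent_coord_vec.
rewrite metric_sum_l//.
under eq_bigr do rewrite aC// metric_sum_l// mulr_sumr.
rewrite exchange_big; apply: eq_bigr => j _ /=.
rewrite mxE mulr_suml; apply: eq_bigr => i _.
by rewrite mxE aC// mulrA mulrAC.
Qed.

Lemma frame_coframe x : cimg c x -> frame x *m coframe x = 1%:M.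
Proof.
move=> cx; apply/matrixP => i j; rewrite /coframe mulmxA !mxE -(orthoE (cinv c x)).
rewrite !frame_vec// metric_gram// /dot; apply: eq_bigr => k _.
rewrite ![in RHS]mxE; congr (_ * _); last by rewrite !mxE.
by rewrite !mxE; apply: eq_bigr => r _; rewrite !mxE.
Qed.

Lemma metric_coframe x y z : cimg c x ->
  a (cinv c x) (coord_vec A c x y) (coord_vec A c x z) =
  dot (y *m coframe x) (z *m coframe x).
Proof.
move=> cx; rewrite metric_gram// dotC [RHS]dotC [RHS]dot_mulmx -mulmxA.
congr (dot z (y *m _)).
have symG : (gram x)^T = gram x.
  apply/matrixP => i j; rewrite !mxE; have [aC _ _ _] := ra.
  by apply: aC; exact: tangent_coord_vec.
rewrite {2}/coframe trmx_mul trmxK symG mulmxA.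
by rewrite (mulmx1C (frame_coframe cx)) mul1mx.
Qed.

Lemma frame_entry i j :
  (fun x => frame x i j) = (fun x => E i (cinv c x) (chart_coord c j) : R).
Proof. by apply/funext => x; rewrite mxE. Qed.

Lemma derivable_frame x v : cimg c x ->
  derivable frame x v.
Proof.
move=> cx; apply/derivable_mxP => i j.
rewrite frame_entry.
by have [_ /(_ v)] := smooth_components j Ac (vE i) [::] cx.
Qed.

Lemma derive_frameE x v i j : cimg c x -> 'D_v frame x i j =
  'D_v (fun z => E i (cinv c z) (chart_coord c j) : R) x.
Proof.
move=> cx; rewrite derive_mx; last exact: derivable_frame.
by rewrite mxE frame_entry.
Qed.

Lemma derivable_gram x v : cimg c x -> derivable gram x v.
Proof.
move=> cx; apply/derivable_mxP => i j; have [_ _ _ sa] := ra.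
have [_ /(_ v)] := sa c Ac (delta_mx 0 i) (delta_mx 0 j) [::] x cx.
rewrite /= (_ : (fun x => gram x i j) = (fun x0 => a (cinv c x0)
  (coord_vec A c x0 (delta_mx 0 i)) (coord_vec A c x0 (delta_mx 0 j)))) //.
by apply/funext => z; rewrite mxE.
Qed.

Lemma derivable_coframe x v : cimg c x -> derivable coframe x v.
Proof.
move=> cx; have dg := derivableP (@derivable_gram x v cx).
have dE := derivableP (@derivable_frame x v cx).
have dET : is_derive x v (fun z => (frame z)^T) ('D_v frame x)^T.
  apply/is_derive_mxP => i j; move/is_derive_mxP : dE => /(_ j i).
  rewrite mxE (_ : (fun z => (frame z)^T i j) = (fun z => frame z j i))//.
  by apply/funext => z; rewrite mxE.
by have [] := is_derive_mulmx dg dET.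
Qed.

Lemma derive_frame_linear x v : cimg c x ->
  'D_v frame x = \sum_r v 0 r *: 'D_(delta_mx 0 r) frame x.
Proof.
move=> cx; apply/matrixP => i j.
rewrite derive_frameE// summxE {1}(row_sum_delta v).
have df := Cinfty_differentiable (@cimg_open _ _ _ c)
  (smooth_components j Ac (vE i)) cx.
rewrite derive_dir_sum//; apply: eq_bigr => r _.
by rewrite [RHS]mxE derive_frameE.
Qed.

(** The derivatives of the frame matrix encode the structure constants. *)
Lemma frame_bracket_lie x i j (w : 'rV[R]_n) : cimg c x ->
  lie_bracket A (E i) (E j) (cinv c x) = \sum_r w 0 r *: E r (cinv c x) ->
  frame_bracket x frame coframe (fun v => 'D_v frame x)
    (delta_mx 0 i) (delta_mx 0 j) = w.
Proof.
move=> cx br; rewrite /frame_bracket -!rowE.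
suff -> : row j ('D_(row i (frame x)) frame x) - row i ('D_(row j (frame x)) frame x)
   = w *m frame x by rewrite -mulmxA frame_coframe// mulmx1.
apply/rowP => k.
transitivity ('D_(row i (frame x)) frame x j k
    - 'D_(row j (frame x)) frame x i k); first by rewrite !mxE.
rewrite (derive_frameE _ j k cx) (derive_frameE _ i k cx) !row_frame.
have := lie_bracket_components k Ac cx (vE i) (vE j); rewrite br => <-.
by rewrite !mxE fct_sumE; apply: eq_bigr => r _; rewrite !mxE.
Qed.

End OrthonormalFrame.

(** * Randers metrics from Randers profiles *)

Section RandersConstruction.
Context {R : realType} {n : nat} {M : topologicalType}.
Variables (A : smooth_structure R n M) (a : M -> tvec R M -> tvec R M -> R).
Variables (beta : M -> tvec R M -> R) (F : M -> tvec R M -> R).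
Variables (phi : R -> R) (b : R).
Hypothesis ra : riemannian A a.
Hypothesis beta_form : one_form A beta.
Hypothesis b_ge0 : 0 <= b.
Hypothesis beta_le : forall p v, tangent A p v ->
  `|beta p v| <= b * riem_norm a p v.

Lemma tangent0 p : tangent A p 0.
Proof.
have [c Ac cp] := atlas_cover A p.
have tx := tangent_coord_vec 0 Ac (cimg_cmap cp); rewrite cmapK// in tx.
by have := tangentZ 0 tx; rewrite scale0r.
Qed.

Lemma metric0 p : a p 0 0 = 0.
Proof.
have [_ aD _ _] := ra; have t0 := tangent0 p.
have := aD p 1 0 0 0 t0 t0 t0; rewrite scale1r addr0 mul1r => /eqP.
by rewrite eq_sym -subr_eq0 addrK => /eqP.
Qed.

Lemma beta0 p : beta p 0 = 0.
Proof.
have [bD _] := beta_form; have t0 := tangent0 p.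
have := bD p 1 0 0 t0 t0; rewrite scale1r addr0 mul1r => /eqP.
by rewrite eq_sym -subr_eq0 addrK => /eqP.
Qed.

Lemma riem_norm2 p v : tangent A p v -> riem_norm a p v ^+ 2 = a p v v.
Proof.
move=> tv; rewrite sqr_sqrtr//; have [_ _ pos _] := ra.
have [->|/(pos p v tv)/ltW//] := eqVneq v 0.
by rewrite metric0.
Qed.

Lemma riem_norm_gt0 p v : tangent A p v -> v != 0 -> 0 < riem_norm a p v.
Proof. by move=> tv v0; have [_ _ pos _] := ra; rewrite sqrtr_gt0 pos. Qed.

Lemma beta_sqr_le p v : tangent A p v -> beta p v ^+ 2 <= b ^+ 2 * a p v v.
Proof.
move=> tv; rewrite -riem_norm2// -exprMn -real_normK ?num_real//.
by rewrite ler_pXn2r ?nnegrE ?mulr_ge0 ?sqrtr_ge0// beta_le.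
Qed.

Lemma ratio_beta_le p v : tangent A p v -> `|beta p v / riem_norm a p v| <= b.
Proof.
move=> tv; have [->|v0] := eqVneq v 0; first by rewrite beta0 mul0r normr0.
have r0 := riem_norm_gt0 tv v0.
by rewrite normrM normfV (gtr0_norm r0) ler_pdivrMr// beta_le.
Qed.

(** The new Riemannian metric is k1 a + k2 beta^2 and the new 1-form is
    k3 beta. As |beta| <= b alpha, the norm of the latter is at most
    |k3| b / sqrt(k1 + k2 b^2), which is less than one because phi is positive
    at b and at -b. *)
Lemma randers_of_randers_function : finsler A F ->
  (forall s, `|s| <= b -> 0 < phi s) ->
  (forall p v, tangent A p v ->
    F p v = riem_norm a p v * phi (beta p v / riem_norm a p v)) ->
  randers_function phi b -> randers A F.
Proof.
move=> finF phi_gt0 FE [k1 [k2 [k3 [k1_gt0 kE]]]]; split=> //.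
have [aC aD apos asm] := ra; have [bD bsm] := beta_form.
pose a' p (u v : tvec R M) := k1 * a p u v + k2 * (beta p u * beta p v).
have a'E p v : tangent A p v -> v != 0 -> a' p v v =
    riem_norm a p v ^+ 2 * (k1 + k2 * (beta p v / riem_norm a p v) ^+ 2).
  move=> tv v0; rewrite /a' -riem_norm2//; field.
  by rewrite gt_eqF// riem_norm_gt0.
exists a', (fun p v => k3 * beta p v); split.
- split.
  + by move=> p u v tu tv; rewrite /a' aC// [beta p u * _]mulrC.
  + by move=> p t u v w tu tv tw; rewrite /a' aD// bD//; ring.
  + move=> p v tv v0; rewrite a'E// mulr_gt0// ?exprn_gt0 ?riem_norm_gt0//.
    by have [] := kE _ (ratio_beta_le tv).
  + move=> c Ac y z.
    pose f x : R := a (cinv c x) (coord_vec A c x y) (coord_vec A c x z).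
    pose g w x : R := beta (cinv c x) (coord_vec A c x w).
    apply: (@Cinfty_eq _ _ _ _ (k1 \*: (f : _ -> R) + k2 \*: (g y * g z))) => //.
      exact: cimg_open.
    apply: CinftyD; [exact: cimg_open | | ].
      by apply: CinftyZ; [exact: cimg_open | exact: asm].
    apply: CinftyZ; first exact: cimg_open.
    by apply: CinftyM; [exact: cimg_open | exact: bsm | exact: bsm].
- split.
    by move=> p t u v tu tv; rewrite bD//; ring.
  move=> c Ac y.
  pose g x : R := beta (cinv c x) (coord_vec A c x y).
  apply: (@Cinfty_eq _ _ _ _ (k3 \*: (g : _ -> R))) => //.
    exact: cimg_open.
  by apply: CinftyZ; [exact: cimg_open | exact: bsm].
- move=> p; have bb : `|b| <= b by rewrite ger0_norm.
  have [kb phib] := kE b bb.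
  have sk : 0 < Num.sqrt (k1 + k2 * b ^+ 2) by rewrite sqrtr_gt0.
  pose r := `|k3| * b / Num.sqrt (k1 + k2 * b ^+ 2).
  have r1 : r < 1.
    rewrite ltr_pdivrMr// mul1r -[b in X in X < _](ger0_norm b_ge0) -normrM.
    have Nb : `|- b| <= b by rewrite normrN.
    have := phi_gt0 b bb; have := phi_gt0 (- b) Nb.
    have [_ ->] := kE _ Nb; rewrite phib sqrrN mulrN => h1 h2.
    by rewrite ltr_norml; apply/andP; split; lra.
  apply: le_lt_trans r1; apply: sup_le_ub.
    exists `|k3 * beta p 0|, 0; split=> //; first exact: tangent0.
    by rewrite /riem_norm /a' metric0 beta0 !mulr0 addr0 sqrtr0.
  move=> _ [v [tv v1 ->]].
  rewrite ler_pdivlMr// -ler_sqr ?nnegrE ?mulr_ge0 ?sqrtr_ge0//.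
  rewrite !exprMn (sqr_sqrtr (ltW kb)) !real_normK ?num_real// exprMn.
  have a'1 : a' p v v <= 1.
    have [neg|pos0] := ltP (a' p v v) 0; first by lra.
    by rewrite -(sqr_sqrtr pos0) expr_le1 ?sqrtr_ge0.
  have bl := beta_sqr_le tv.
  have h : k1 * beta p v ^+ 2 <= k1 * (b ^+ 2 * a p v v) by rewrite ler_pM2l.
  have h2 : b ^+ 2 * a' p v v <= b ^+ 2 * 1 by rewrite ler_wpM2l// sqr_ge0.
  rewrite -mulrA ler_wpM2l ?sqr_ge0//.
  by move: h2; rewrite /a' => h2; nra.
- move=> p v tv; rewrite FE//.
  have [->|v0] := eqVneq v 0.
    by rewrite /riem_norm /a' metric0 beta0 !mulr0 !addr0 sqrtr0 mul0r.
  have r0 := riem_norm_gt0 tv v0.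
  have [ks ->] := kE _ (ratio_beta_le tv).
  rewrite -[riem_norm a' p v]/(Num.sqrt (a' p v v)) a'E// sqrtrM ?sqr_ge0//.
  rewrite sqrtr_sqr gtr0_norm//.
  by rewrite mulrDr; congr (_ + _); field; rewrite gt_eqF.
Qed.

End RandersConstruction.

(** * Invariant fields and the Lie algebra of the theorem *)

Section FrameField.
Context {R : realType} {n : nat} {M : topologicalType}.
Variables (A : smooth_structure R n M) (a : M -> tvec R M -> tvec R M -> R).
Variables (E : 'I_n -> vfield R M) (X : vfield R M) (xi : 'rV[R]_n).
Hypothesis ra : riemannian A a.
Hypothesis vE : forall i, is_vector_field A (E i).
Hypothesis orthoE : forall p i j, a p (E i p) (E j p) = (i == j)%:R.
Hypothesis vX : is_vector_field A X.
Hypothesis XE : X = \sum_i xi 0 i *: E i.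

Lemma field_coord_vec c x : atlas A c -> cimg c x ->
  X (cinv c x) = coord_vec A c x (xi *m frame c E x).
Proof.
move=> Ac cx; rewrite (coord_vec_components Ac cx (vX.1 _)); congr coord_vec.
apply/rowP => j; rewrite !mxE XE !fct_sumE; apply: eq_bigr => i _.
by rewrite !mxE.
Qed.

Lemma form_coframe c x y : atlas A c -> cimg c x ->
  a (cinv c x) (coord_vec A c x y) (X (cinv c x)) =
  dot xi (y *m coframe A a c E x).
Proof.
move=> Ac cx; rewrite field_coord_vec// (metric_coframe ra Ac vE orthoE)//.
by rewrite -mulmxA (frame_coframe ra Ac vE orthoE)// mulmx1 dotC.
Qed.

Lemma norm_coframe c x y : atlas A c -> cimg c x ->
  riem_norm a (cinv c x) (coord_vec A c x y) = len (y *m coframe A a c E x).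
Proof. by move=> Ac cx; rewrite /riem_norm (metric_coframe ra Ac vE orthoE). Qed.

Lemma norm_field p : riem_norm a p (X p) = len xi.
Proof.
have [c Ac cp] := atlas_cover A p; have cx := cimg_cmap cp.
rewrite -[p](cmapK cp) field_coord_vec// norm_coframe//.
by rewrite -mulmxA (frame_coframe ra Ac vE orthoE)// mulmx1.
Qed.

Lemma form_field_le p v : tangent A p v ->
  `|a p v (X p)| <= len xi * riem_norm a p v.
Proof.
have [c Ac cp] := atlas_cover A p; have cx := cimg_cmap cp.
rewrite -[p](cmapK cp) => tv; rewrite (coord_vec_components Ac cx tv).
rewrite form_coframe// norm_coframe//; apply: dot_len_le; first exact: sqrtr_ge0.
by rewrite len2.
Qed.

(** The supremum in the norm of beta is reached at X / |X|. *)
Lemma len_le_form_norm p : len xi <= form_norm A a (form_of_field a X) p.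
Proof.
rewrite /form_norm; set S := [set r | _].
have ubS : has_ubound S.
  exists (len xi) => _ [v [tv v1 ->]].
  apply: le_trans (form_field_le tv) _.
  by rewrite ler_piMr// sqrtr_ge0.
have [l0|l0] := eqVneq (len xi) 0.
  rewrite l0; apply: (@le_trans _ _ `|form_of_field a X p 0|) => //.
  apply: ub_le_sup => //; exists 0; split=> //; first exact: tangent0.
  by rewrite /riem_norm (metric0 ra) sqrtr0.
pose v := (len xi)^-1 *: X p.
have tX := vX.1 p; have tv : tangent A p v by apply: tangentZ.
have [aC aD _ _] := ra.
have aZ u : tangent A p u -> a p v u = (len xi)^-1 * a p (X p) u.
  move=> tu; have := aD p (len xi)^-1 (X p) 0 u tX (tangent0 A p) tu.
  have a0 : a p 0 u = 0.
    have := aD p (-1) 0 0 u (tangent0 A p) (tangent0 A p) tu.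
    by rewrite scaler0 addr0 mulN1r addNr.
  by rewrite a0 !addr0.
have XX : a p (X p) (X p) = len xi ^+ 2.
  by rewrite -(riem_norm2 ra tX) norm_field.
apply: ub_le_sup => //; exists v; split=> //.
  rewrite /riem_norm aZ// aC// aZ// XX.
  by rewrite (_ : _ * _ = 1) ?sqrtr1//; field.
by rewrite /form_of_field aZ// XX expr2 mulKf// ger0_norm// sqrtr_ge0.
Qed.

End FrameField.

(** This is the case X = 0, where phi matters at s = 0 only. *)
Lemma randers_function0 {R : realType} (phi : R -> R) :
  0 < phi 0 -> randers_function phi 0.
Proof.
move=> phi0; exists (phi 0 ^+ 2), 0, 0; split; first by rewrite exprn_gt0.
move=> s; rewrite normr_le0 => /eqP ->.
by rewrite !mul0r !addr0 sqrtr_sqr gtr0_norm// exprn_gt0.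
Qed.

Lemma Cinfty_derive1n {R : realType} (U : set R) (phi : R -> R) :
  Cinfty U (phi : R -> R^o) -> forall m (s : R), U s ->
  {for s, continuous (phi^`(m))%classic} /\
  is_derive s 1 (phi^`(m))%classic ((phi^`(m.+1))%classic s).
Proof.
move=> Cphi m s Us.
have iterE k : (phi^`(k))%classic = iter_derive (nseq k (1 : R)) (phi : R -> R^o).
  elim: k => //= k <-; apply/funext => t; exact: derive1E.
have [cphi dphi] := Cphi (nseq m (1 : R)) s Us.
rewrite iterE; split=> //.
by rewrite iterE; split.
Qed.

Section L59.
Context {R : realType}.
(* Indices start at 0: e 0, ..., e 4 stand for E1, ..., E5. *)
Local Notation e k := (delta_mx 0 (inord k) : 'rV[R]_5).
Variables (br : 'rV[R]_5 -> 'rV[R]_5 -> 'rV[R]_5) (xi : 'rV[R]_5) (k l m p q : R).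
Hypothesis brDl : forall t u v w, br (t *: u + v) w = t *: br u w + br v w.
Hypothesis brDr : forall t u v w, br w (t *: u + v) = t *: br w u + br w v.
Hypothesis br_alt : forall u, br u u = 0.
Hypothesis br12 : br (e 0) (e 1) = k *: e 2 + l *: e 3 + m *: e 4.
Hypothesis br13 : br (e 0) (e 2) = p *: e 3.
Hypothesis br23 : br (e 1) (e 2) = q *: e 4.
Hypotheses (k_gt0 : 0 < k) (p_gt0 : 0 < p) (q_gt0 : 0 < q).

(** If beta is closed, xi is orthogonal to E3, E4 and E5. For
    nu = - xi_2 E1 + xi_1 E2 + E3 the bracket of xi and nu has E3-component
    k |xi|^2 and no component along E1 and E2, so <nu, [xi, nu]> = k |xi|^2. *)
Lemma l59_nonkilling_direction : xi != 0 -> (forall u w, dot xi (br u w) = 0) ->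
  exists2 nu, dot xi nu = 0 & dot nu (br xi nu) != 0.
Proof.
move=> xi0 closed.
have x3 : xi 0 (inord 3) = 0.
  have := closed (e 0) (e 2); rewrite br13 dotZr dot_delta => /eqP.
  by rewrite mulf_eq0 gt_eqF//= => /eqP.
have x4 : xi 0 (inord 4) = 0.
  have := closed (e 1) (e 2); rewrite br23 dotZr dot_delta => /eqP.
  by rewrite mulf_eq0 gt_eqF//= => /eqP.
have x2 : xi 0 (inord 2) = 0.
  have := closed (e 0) (e 1); rewrite br12 !dotDr !dotZr !dot_delta x3 x4.
  by rewrite !mulr0 !addr0 => /eqP; rewrite mulf_eq0 gt_eqF//= => /eqP.
pose x0 := xi 0 (inord 0); pose x1 := xi 0 (inord 1).
have xiE : xi = x0 *: e 0 + x1 *: e 1.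
  apply/rowP => i; rewrite !mxE /= /x0 /x1.
  have ordE (j : nat) : (j < 5)%N -> (i == inord j) = (i == j :> nat).
    by move=> j5; rewrite -val_eqE /= inordK.
  rewrite !ordE//.
  case: i {ordE} => -[|[|[|[|[|//]]]]] i5 /=;
    rewrite ?mulr0 ?mulr1 ?addr0 ?add0r.
  - by congr (xi 0 _); apply/val_inj; rewrite /= inordK.
  - by congr (xi 0 _); apply/val_inj; rewrite /= inordK.
  - by rewrite -x2; congr (xi 0 _); apply/val_inj; rewrite /= inordK.
  - by rewrite -x3; congr (xi 0 _); apply/val_inj; rewrite /= inordK.
  - by rewrite -x4; congr (xi 0 _); apply/val_inj; rewrite /= inordK.
pose b2 := x0 ^+ 2 + x1 ^+ 2.
have b2_gt0 : 0 < b2.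
  have := dot_gt0 xi0; rewrite {2}xiE dotDr !dotZr !dot_delta -/x0 -/x1.
  by rewrite /b2 !expr2.
have brZl := alternatingZl brDl.
have br21 : br (e 1) (e 0) = - br (e 0) (e 1) := alternatingC brDl brDr br_alt _ _.
exists (- x1 *: e 0 + (x0 *: e 1 + e 2)).
  rewrite !dotDr !dotZr !dot_delta -/x0 -/x1 x2; ring.
have -> : br xi (- x1 *: e 0 + (x0 *: e 1 + e 2)) =
    b2 *: (k *: e 2 + l *: e 3 + m *: e 4) + ((x0 * p) *: e 3 + (x1 * q) *: e 4).
  rewrite xiE brDl brZl !brDr !br_alt br21 br12 br13 br23 /b2.
  apply/rowP => i; rewrite !mxE; ring.
have dd (i j : nat) : (i < 5)%N -> (j < 5)%N ->
    (e i : 'rV[R]_5) 0 (inord j) = (i == j)%:R.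
  by move=> i5 j5; rewrite mxE eqxx /= -val_eqE /= !inordK// eq_sym.
rewrite !(dotDl, dotDr, dotZl, dotZr) !dot_delta !dd//=.
rewrite (_ : _ + _ = b2 * k); last by rewrite /= ; ring.
by rewrite mulf_neq0// gt_eqF.
Qed.

End L59.

(** * The theorem *)

Unset Implicit Arguments.

Theorem theorem3p14 (R : realType) (G : topGroupCarrierType)
    (A : smooth_structure R 5 G)
    (a : G -> tvec R G -> tvec R G -> R)
    (E1 E2 E3 E4 E5 : vfield R G) (k l m p q : R)
    (F : G -> tvec R G -> R) (X : vfield R G) :
  is_lie_group A -> simply_connected R G -> nilpotent_group G ->
  riemannian A a -> left_invariant_riem A a ->
  let E := tnth [tuple E1; E2; E3; E4; E5] in
  lie_algebra_basis A E ->
  (forall g i j, a g (E i g) (E j g) = (i == j)%:R) ->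
  lie_bracket A E1 E2 = k *: E3 + l *: E4 + m *: E5 ->
  lie_bracket A E1 E3 = p *: E4 ->
  lie_bracket A E2 E3 = q *: E5 ->
  lie_bracket A E1 E4 = 0 -> lie_bracket A E1 E5 = 0 ->
  lie_bracket A E2 E4 = 0 -> lie_bracket A E2 E5 = 0 ->
  lie_bracket A E3 E4 = 0 -> lie_bracket A E3 E5 = 0 ->
  lie_bracket A E4 E5 = 0 ->
  [\/ [/\ 0 < k, 0 < p, p < q, 0 <= l & 0 <= m]
    | [/\ 0 < k, 0 < p, 0 <= l, m = 0 & q = p]] ->
  left_invariant_field A X ->
  alpha_beta_metric A a (form_of_field a X) F ->
  left_invariant_finsler A F ->
  ~ riemannian_finsler A F ->
  douglas A F ->
  randers A F.
Proof.
move=> _ _ _ ra _ E [liE spanE] orthoE br12 br13 br23 _ _ _ _ _ _ _ params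
  liX [finF _ form_beta [b0 [phi [b0_gt0 [Cphi phi_gt0] convex beta_lt FE]]]]
  _ _ doug.
have k_gt0 : 0 < k by case: params => [[]|[]].
have p_gt0 : 0 < p by case: params => [[]|[]].
have q_gt0 : 0 < q.
  by case: params => [[_ p0 pq _ _]|[_ p0 _ _ ->//]]; exact: lt_trans pq.
have vE i : is_vector_field A (E i) := (liE i).1.
have vX : is_vector_field A X := liX.1.
have [xi [XE _]] := spanE X liX.
pose b := len xi; have b_ge0 : 0 <= b by exact: sqrtr_ge0.
have b_lt : b < b0.
  exact: le_lt_trans (len_le_form_norm ra vE orthoE vX XE 1%g) (beta_lt 1%g).
have dphi m' s (sb : `|s| < b0) := Cinfty_derive1n Cphi m' sb.
have phi_pos s : `|s| <= b -> 0 < phi s.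
  by move=> sb; apply: phi_gt0; exact: le_lt_trans sb b_lt.
apply: (randers_of_randers_function ra form_beta b_ge0 _ finF phi_pos FE).
  by move=> g v tv; exact: (form_field_le ra vE orthoE vX XE tv).
have [xi0|xi_neq0] := eqVneq xi 0.
  have -> : b = 0 by rewrite /b xi0 /len dot0r sqrtr0.
  by apply: randers_function0; apply: phi_pos; rewrite normr0.
have b_gt0 : 0 < b by exact: len_gt0.
have [c Ac c1] := atlas_cover A 1%g; pose x0 := cmap c 1%g.
have cx0 : cimg c x0 := cimg_cmap c1.
have [Gam [P [_ sprayE]]] := doug c Ac.
have frameE : forall x, cimg c x -> frame c E x *m coframe A a c E x = 1%:M.
  exact: frame_coframe ra Ac vE orthoE.
pose dE v := 'D_v (frame c E) x0.
have dE_frame v : is_derive x0 v (frame c E) (dE v).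
  by apply: derivableP; exact: derivable_frame Ac vE _ _ cx0.
have dE_lin := fun v => derive_frame_linear Ac vE v cx0.
have d_coframe v : derivable (coframe A a c E) x0 v.
  exact: derivable_coframe ra Ac vE _ _ cx0.
have xi2 : dot xi xi = b ^+ 2 by rewrite len2.
have Fframe x y : cimg c x -> local_expr A F c x y =
    len (y *m coframe A a c E x) * phi (slope xi (y *m coframe A a c E x)).
  move=> cx; rewrite /local_expr FE; last exact: tangent_coord_vec.
  rewrite (norm_coframe ra vE orthoE _ Ac)// /form_of_field.
  by rewrite (form_coframe ra vE orthoE vX XE _ Ac).
have [_ _ _ pos] := finF.
have hamel := hamel_of_douglas b_ge0 b_lt (fun s sb => (dphi 0%N s sb).2)
  (fun s sb => (dphi 1%N s sb).2) xi2 cx0 Fframe frameE dE_frame dE_lin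
  d_coframe phi_pos (fun y w => pos c Ac x0 y w cx0)
  (fun y y0 => sprayE x0 y cx0 y0).
pose br := frame_bracket x0 (frame c E) (coframe A a c E) dE.
have br_lie i j (w : 'rV[R]_5) : lie_bracket A (E i) (E j) = \sum_r w 0 r *: E r ->
    br (delta_mx 0 i) (delta_mx 0 j) = w.
  move=> lieE; apply: (frame_bracket_lie ra Ac vE orthoE cx0).
  by rewrite lieE fct_sumE.
have [EE0 EE1 EE2 EE3 EE4] : [/\ E (inord 0) = E1, E (inord 1) = E2,
    E (inord 2) = E3, E (inord 3) = E4 & E (inord 4) = E5].
  by split; rewrite /E (tnth_nth E1) inordK.
have sum_delta i : \sum_r (delta_mx 0 i : 'rV[R]_5) 0 r *: E r = E i.
  rewrite (bigD1 i)//= mxE !eqxx scale1r big1 ?addr0// => j /negPf ji.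
  by rewrite mxE ji andbF scale0r.
have sumZD (t : R) (u w : 'rV[R]_5) : \sum_r (t *: u + w) 0 r *: E r =
    t *: (\sum_r u 0 r *: E r) + \sum_r w 0 r *: E r.
  rewrite scaler_sumr -big_split; apply: eq_bigr => r _.
  by rewrite !mxE scalerDl scalerA.
have sumZ (t : R) (u : 'rV[R]_5) : \sum_r (t *: u) 0 r *: E r =
    t *: (\sum_r u 0 r *: E r).
  by rewrite scaler_sumr; apply: eq_bigr => r _; rewrite !mxE scalerA.
have brDl t u v w : br (t *: u + v) w = t *: br u w + br v w.
  exact: frame_bracketDl dE_lin _ _ _ _.
have brDr t u v w : br w (t *: u + v) = t *: br w u + br w v.
  exact: frame_bracketDr dE_lin _ _ _ _.
have gam_quad := quadratic_frame_spray x0 (frame c E) (coframe A a c E) dE_lin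
   (fun i j r => Gam i j r x0).
have A_gt0 s : `|s| <= b -> 0 < phi s - s * (phi^`(1))%classic s.
  move=> sb; have := convex s `|s| (lexx _) (le_lt_trans sb b_lt).
  by rewrite real_normK ?num_real// subrr mul0r addr0.
have D_gt0 s : `|s| <= b -> 0 < phi s - s * (phi^`(1))%classic s
    + (b ^+ 2 - s ^+ 2) * (phi^`(2))%classic s.
  by move=> sb; exact: convex.
have br_alt u : br u u = 0 by exact: frame_bracket_alt.
have H := randers_function_of_hamel b_gt0 b_lt (fun s sb => (dphi 0%N s sb).2)
  (fun s sb => (dphi 1%N s sb).2) (fun s sb => (dphi 2%N s sb).1) phi_pos
  A_gt0 D_gt0 xi2 brDl brDr br_alt gam_quad hamel.
apply: H => //.
move=> closed; apply: (l59_nonkilling_direction (k := k) (l := l) (m := m) (p := p) (q := q)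
    brDl brDr br_alt) => //; apply: br_lie.
- rewrite EE0 EE1 br12 -addrA.
  by rewrite -addrA sumZD sumZD sumZ !sum_delta EE2 EE3 EE4.
- by rewrite EE0 EE2 br13 sumZ sum_delta EE3.
- by rewrite EE1 EE2 br23 sumZ sum_delta EE4.
Qed.
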